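(* Let $D\subset\mathbb{R}^d$ be a bounded convex domain. Let $(g_t,p_t)$ be a smooth solution to the Euler equations $$\frac{d^2g_t}{dt^2}\circ g_t^{-1}+\nabla p_t=0$$ on a time interval $[t_0,t_1]$ small enough so that $$(t_1-t_0)^2\,D^2p_t(x)\le\pi^2\qquad\text{for all }x\in D$$ (in the sense of symmetric matrices). Then $p_t$ is a maximizer of the concave functional $$q\ \mapsto\ \int_{t_0}^{t_1}\int_D q_t(x)\,dt\,dx+\int_D J_q[g_{t_0}(x),g_{t_1}(x)]\,dx$$ among all $t$ dependent scalar fields $q_t$ defined on $D$. Here $$J_q[x,y]=\inf\int_{t_0}^{t_1}\Big(-q_t(z(t))+\frac{|z'(t)|^2}{2}\Big)dt,$$ where the infimum is taken over all curves $t\mapsto z(t)\in D$ such that $z(t_0)=x\in D$ and $z(t_1)=y\in D$, is defined for all pairs of points $(x,y)$ in $D$.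
   Context: $SDiff(D)$ is the set of all orientation and volume preserving diffeomorphisms of $D$. A solution of the Euler equations (for an incompressible inviscid fluid moving inside $D$) is a curve $t\mapsto g_t$ along $SDiff(D)$ satisfying the displayed equation, where $p_t$ is a time dependent scalar field defined on $D$ (the pressure field). $D^2p_t$ is the Hessian matrix of $p_t$ with respect to $x$; in the smallness condition, which concerns the times $t$ in $[t_0,t_1]$, $\pi^2$ stands for $\pi^2$ times the identity matrix. *)

(* Defs.v *)
From HB Require Import structures.
From mathcomp Require Import all_boot all_order all_algebra.
From mathcomp Require Import all_classical all_reals all_analysis.

Set Implicit Arguments.
Unset Strict Implicit.
Unset Printing Implicit Defensive.

Import Order.TTheory GRing.Theory Num.Theory.
Import numFieldNormedType.Exports.

Local Open Scope classical_set_scope.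
Local Open Scope ring_scope.

(* Borel sigma-algebra of R^n, generated by the coordinates; as in the library's
   instance on n.-tuple T. *)
Definition rV_display : measure_display.
Proof. exact: (measure_tuple_display default_measure_display). Qed.

Section measurable_rV.
Context {R : realType} (n : nat).

Definition rV_coord (i : 'I_n) (x : 'rV[R]_n) : measurableTypeR R := x ord0 i.

Let rV_set0 : g_sigma_preimage rV_coord set0.
Proof. exact: sigma_algebra0. Qed.

Let rV_setC A : g_sigma_preimage rV_coord A -> g_sigma_preimage rV_coord (~` A).
Proof. exact: sigma_algebraC. Qed.

Let rV_bigcup (F : (set 'rV[R]_n)^nat) :
  (forall i, g_sigma_preimage rV_coord (F i)) ->
  g_sigma_preimage rV_coord (\bigcup_i F i).
Proof. exact: sigma_algebra_bigcup. Qed.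

HB.instance Definition _ := @isMeasurable.Build rV_display
  'rV[R]_n (g_sigma_preimage rV_coord) rV_set0 rV_setC rV_bigcup.

Lemma measurable_rV_coord (i : 'I_n) : measurable_fun [set: 'rV[R]_n] (rV_coord i).
Proof.
move=> _ Y mY; rewrite setTI; apply: sub_sigma_algebra => /=.
rewrite -bigcup_seq/=; exists i => /=; first by rewrite mem_index_enum.
by exists Y => //; rewrite setTI.
Qed.

Lemma measurable_fun_rV d (T : measurableType d) (f : T -> 'rV[R]_n) :
  (forall i, measurable_fun [set: T] (rV_coord i \o f)) ->
  measurable_fun [set: T] f.
Proof.
move=> mf _ A mA; rewrite setTI.
have : preimage_set_system [set: T] f (g_sigma_preimage rV_coord) `<=` measurable.
  rewrite -g_sigma_preimage_comp.
  apply: smallest_sub; first exact: sigma_algebra_measurable.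
  rewrite -bigcup_seq/=; apply: bigcup_sub => i _ B [C mC <-].
  exact: mf.
by apply; exists A => //; rewrite setTI.
Qed.

End measurable_rV.

Section lebesgue_rV.
Context {R : realType}.

Definition rV_cons n (x : measurableTypeR R * 'rV[R]_n) : 'rV[R]_n.+1 :=
  \row_i if unlift ord0 i is Some j then x.2 ord0 j else x.1.

Definition rV_uncons n (x : 'rV[R]_n.+1) : measurableTypeR R * 'rV[R]_n :=
  (x ord0 ord0, \row_(i < n) x ord0 (lift ord0 i)).

Lemma rV_consE0 n (x : measurableTypeR R * 'rV[R]_n) :
  rV_cons x ord0 ord0 = x.1.
Proof. by rewrite mxE unlift_none. Qed.

Lemma rV_consEl n (x : measurableTypeR R * 'rV[R]_n) i :
  rV_cons x ord0 (lift ord0 i) = x.2 ord0 i.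
Proof. by rewrite mxE liftK. Qed.

Lemma rV_consK n : cancel (@rV_cons n) (@rV_uncons n).
Proof.
move=> -[a v]; rewrite /rV_uncons rV_consE0; congr pair.
by apply/rowP => i; rewrite mxE rV_consEl.
Qed.

Lemma measurable_rV_cons n :
  measurable_fun [set: measurableTypeR R * 'rV[R]_n] (@rV_cons n).
Proof.
apply: measurable_fun_rV => i; have [->|[j ->]] : i = ord0 \/ exists j, i = lift ord0 j.
- by case: (unliftP ord0 i) => [j ->|->]; [right; exists j|left].
- rewrite (_ : _ \o _ = fst); first exact: measurable_fst.
  by apply/funext => x /=; rewrite /rV_coord rV_consE0.
- rewrite (_ : _ \o _ = rV_coord j \o snd).
    by apply: measurableT_comp; [exact: measurable_rV_coord|exact: measurable_snd].
  by apply/funext => x /=; rewrite /rV_coord rV_consEl.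
Qed.

Lemma measurable_rV_uncons n :
  measurable_fun [set: 'rV[R]_n.+1] (@rV_uncons n).
Proof.
apply: measurable_fun_pair; first exact: (measurable_rV_coord ord0).
apply: measurable_fun_rV => i.
rewrite (_ : _ \o _ = rV_coord (lift ord0 i)); first exact: measurable_rV_coord.
by apply/funext => x /=; rewrite /rV_coord mxE.
Qed.

Section step.
Variables (n : nat) (mu : {sigma_finite_measure set 'rV[R]_n -> \bar R}).

Definition lebesgue_rV_step : set 'rV[R]_n.+1 -> \bar R :=
  pushforward (@lebesgue_measure R \x mu)%E (@rV_cons n).

HB.instance Definition _ := Measure.copy lebesgue_rV_step
  (measure_function_pushforward__canonical__measure_function_Measure
    (@lebesgue_measure R \x mu)%E (@measurable_rV_cons n)).

Let step_sigma_finite : sigma_finite setT lebesgue_rV_step.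
Proof.
have /sigma_finiteP[F [TF ndF Foo]] := sigma_finiteT (@lebesgue_measure R).
have /sigma_finiteP[G [TG ndG Goo]] := sigma_finiteT mu.
exists (fun k => @rV_uncons n @^-1` (F k `*` G k)).
  rewrite -preimage_bigcup; apply/esym/seteqP; split => // x _ /=.
  have : [set: measurableTypeR R] (rV_uncons x).1 by [].
  have : [set: 'rV[R]_n] (rV_uncons x).2 by [].
  rewrite TF TG => -[i _ Gi] [j _ Fj]; exists (maxn i j) => //; split.
    by move: Fj; exact/subsetPset/ndF/leq_maxr.
  by move: Gi; exact/subsetPset/ndG/leq_maxl.
move=> k; have [mF Fkoo] := Foo k; have [mG Gkoo] := Goo k; split.
  rewrite -[X in measurable X]setTI; apply: measurable_rV_uncons => //.
  exact: measurableX.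
rewrite /lebesgue_rV_step /pushforward -comp_preimage.
rewrite (_ : _ \o _ = id); last by apply/funext => x /=; rewrite rV_consK.
by rewrite preimage_id product_measure1E// lte_mul_pinfty// ge0_fin_numE.
Qed.

HB.instance Definition _ :=
  Measure_isSigmaFinite.Build _ _ _ lebesgue_rV_step step_sigma_finite.

End step.

(* Lebesgue measure on R^n, as the n-fold product of the one on R. *)
Fixpoint lebesgue_rV n : {sigma_finite_measure set 'rV[R]_n -> \bar R} :=
  if n is m.+1 then lebesgue_rV_step (lebesgue_rV m) else \d_(0 : 'rV[R]_0).

End lebesgue_rV.

Section smoothness.
Context {R : realType} {V W : normedModType R}.

Fixpoint class_C (k : nat) (U : set V) (f : V -> W) : Prop :=
  if k is k'.+1
  then (forall x, U x -> differentiable f x) /\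
       (forall v, class_C k' U (fun x => 'D_v f x))
  else {in U, continuous f}.

(* On a set A that need not be open, C^k means C^k on some open neighbourhood
   of A.  At the points of A the two-sided derivatives of f then agree with the
   one-sided ones, so time derivatives at the ends of [t0, t1] make sense. *)
Definition class_C_on (k : nat) (A : set V) (f : V -> W) : Prop :=
  exists U, [/\ open U, A `<=` U & class_C k U f].

Definition smooth_on (A : set V) (f : V -> W) : Prop :=
  exists U, [/\ open U, A `<=` U & forall k, class_C k U f].

End smoothness.

Section euler.
Context {R : realType} {d : nat}.
Local Notation E := 'rV[R]_d.
Implicit Types (D : set E) (p q : R -> E -> R) (g : R -> E -> E).

(* The library's norm on 'rV[R]_d is the sup norm, hence the following. *)
Definition sqnorm (v : E) : R := \sum_(i < d) v ord0 i ^+ 2.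

Definition gradient (f : E -> R) (x : E) : E :=
  \row_i 'D_(delta_mx ord0 i) f x.

Definition hessian (f : E -> R) (x : E) : 'M[R]_d :=
  \matrix_(i, j) 'D_(delta_mx ord0 i) ('D_(delta_mx ord0 j) f) x.

Definition loewner_le (A B : 'M[R]_d) : Prop :=
  forall v : E, (v *m A *m v^T) ord0 ord0 <= (v *m B *m v^T) ord0 ord0.

Definition bounded_convex_domain D : Prop :=
  [/\ open D, D !=set0, bounded_set D & convex_set (D : set (convex_lmodType E))].

Definition inv_on D (f : E -> E) : E -> E := 'pinv_(fun=> 0) D f.

Record SDiff D (f : E -> E) : Prop := {
  SDiff_bij : set_bij D D f;
  SDiff_smooth : smooth_on D f;
  SDiff_smooth_inv : smooth_on D (inv_on D f);
  SDiff_orientation : forall x, D x -> 0 < \det ('J f x);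
  SDiff_volume : forall A : set E, measurable A -> A `<=` D ->
    lebesgue_rV d (D `&` f @^-1` A) = lebesgue_rV d A }.

Definition spacetime D (t0 t1 : R) : set (R * E) := `[t0, t1]%classic `*` D.

Record smooth_euler_solution D (t0 t1 : R) g p : Prop := {
  euler_smooth_flow : smooth_on (spacetime D t0 t1) (fun z => g z.1 z.2);
  euler_smooth_pressure :
    smooth_on (spacetime D t0 t1) (fun z => p z.1 z.2 : R^o);
  euler_SDiff : forall t, t \in `[t0, t1] -> SDiff D (g t);
  euler_eq : forall t x, t \in `[t0, t1] -> D x ->
    derive1n 2 (fun s => g s (inv_on D (g t) x)) t + gradient (p t) x = 0 }.

Definition spacetime_integrable D (t0 t1 : R) q : Prop :=
  (@lebesgue_measure R \x lebesgue_rV d)%E.-integrable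
    (spacetime D t0 t1 : set (measurableTypeR R * E)) (fun z => (q z.1 z.2)%:E).

(* Continuity makes the action finite along every C^1 curve in D, so that J_q is
   defined at all pairs of points of D; integrability gives a meaning to the
   double integral of q, as D is open and q may be unbounded near its boundary. *)
Definition scalar_field D (t0 t1 : R) q : Prop :=
  {within spacetime D t0 t1, continuous (fun z : R * E => q z.1 z.2 : R)} /\
  spacetime_integrable D t0 t1 q.

Definition curves D (t0 t1 : R) (x y : E) : set (R -> E) :=
  [set z | [/\ class_C_on 1 `[t0, t1]%classic (z : R^o -> E),
               (forall t, t \in `[t0, t1] -> D (z t)), z t0 = x & z t1 = y]].

Definition action (t0 t1 : R) q (z : R -> E) : \bar R :=
  (\int[lebesgue_measure]_(t in `[t0, t1])
     (- q t (z t) + sqnorm (derive1 z t) / 2)%:E)%E.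

Definition J D (t0 t1 : R) q (x y : E) : \bar R :=
  ereal_inf [set action t0 t1 q z | z in curves D t0 t1 x y].

(* If x |-> J_q[g_t0(x), g_t1(x)] has both its positive and its negative part of
   infinite integral, the library's integral is -oo, as suits a concave
   functional. *)
Definition dual_functional D (t0 t1 : R) g q : \bar R :=
  (\int[lebesgue_measure]_(t in `[t0, t1]) \int[lebesgue_rV d]_(x in D)
     (q t x)%:E
   + \int[lebesgue_rV d]_(x in D) J D t0 t1 q (g t0 x) (g t1 x))%E.

Definition concave_on (F : set (R -> E -> R)) (Phi : (R -> E -> R) -> \bar R) :=
  forall q1 q2 (l : R), F q1 -> F q2 -> 0 <= l <= 1 ->
    (l%:E * Phi q1 + (1 - l)%:E * Phi q2
     <= Phi (fun t x => (l * q1 t x + (1 - l) * q2 t x)%R))%E.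

Definition maximizer_on (F : set (R -> E -> R)) (Phi : (R -> E -> R) -> \bar R) p :=
  F p /\ forall q, F q -> (Phi q <= Phi p)%E.

End euler.

(* Main.v *)
Require Import Defs.
From HB Require Import structures.
From mathcomp Require Import all_boot all_order all_algebra.
From mathcomp Require Import all_classical all_reals all_analysis.
From mathcomp Require Import measurable_realfun lra ring.

Import Order.TTheory GRing.Theory Num.Theory.
Import numFieldNormedType.Exports.

Local Open Scope classical_set_scope.
Local Open Scope ring_scope.

(** Let [Q q x] be the integral of [q] along the particle path
[t |-> g t x] and [K x] the kinetic action of that path.  Both claims compare
the dual functional [Phi] with the number [\int_D K], which does not depend on
the potential and may be infinite.

Upper bound.  The particle path is a competitor in the definition of [J q], so
[J q <= - Q q + K] at every particle.  Every [g t] preserves the volume, hence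
so does the space-time map [(t, x) |-> (t, g t x)] ([flow_map_volume]), and by
Fubini [\int_D Q q] is the space-time integral of [q].  Adding it to the
integral of [J q] gives [Phi q <= \int_D K] ([dual_functional_upper]).

Lower bound.  For the pressure, the particle path is a minimizer
([J_pressure]).  If [h] is the difference between a competitor and the path,
convexity of [D] and the bound on the Hessian give a second order upper bound
of [p] along the segment ([pressure_taylor]); the Euler equation says that the
acceleration of the path is [- grad p], so the first order terms form an exact
derivative, and what remains is the integral of
[|h'|^2 - (pi / (t1 - t0))^2 |h|^2], which is nonnegative because [h] vanishes
at both ends.  This sharp Poincare inequality and the integration by parts are
done at once by a calibration ([calibrated_action]): for [om < pi / (t1 - t0)]
the function [w = - om tan (om (t - (t0 + t1) / 2))] solves
[w' = - (om^2 + w^2)] on the whole interval, and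
[|h'|^2 - om^2 |h|^2 = |h' - w h|^2 + (w |h|^2)']; then [om] tends to
[pi / (t1 - t0)] ([trajectory_minimizes]).  Hence [J p >= - Q p + K] and
[Phi p >= \int_D K] ([dual_functional_pressure_lower]).

Concavity.  [J] is an infimum of functions that are affine in the potential
([J_concave]).  To integrate this inequality, [x |-> J q (g t0 x) (g t1 x)] has
to be measurable: it is upper semicontinuous, because a nearly optimal curve can
be moved to nearby end points by adding a small affine function of time
([J_upper_semicontinuous]).  As [J q] may take the value [-oo] and have
infinite integrals, superadditivity of the integral is needed beyond integrable
functions ([le_integralD]). *)

(** * Borel sets of space-time *)
Section borel_spacetime.
Context {R : realType} {n : nat}.
Local Notation E := 'rV[R]_n.
Local Notation T := (measurableTypeR R * E)%type.

Lemma measurable_rV_ball (c : E) (e : R) : measurable (ball c e).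
Proof.
have [e0|e0] := ltP 0 e; last first.
  rewrite (_ : ball _ _ = set0)//; apply/seteqP; split => // x [/=].
  by rewrite ltNge e0.
rewrite (_ : ball c e =
    \bigcap_(i in [set: 'I_n]) (rV_coord i @^-1` ball (c ord0 i) e)); last first.
  apply/seteqP; split => [x [_ /= h] i _|x /= h]; first exact: h.
  by split => // i j; rewrite (ord1 i); exact: h.
apply: fin_bigcap_measurable => // i _.
rewrite -[X in measurable X]setTI; apply: measurable_rV_coord => //.
by apply: open_measurable; exact: ball_open.
Qed.

(** The boxes with rational centres and radii [1 / k.+1] form a countable base
of the topology, so the product of the Borel sigma-algebras contains all open
sets. *)
Lemma open_measurable_spacetime (U : set (R * E)) :
  open U -> measurable (U : set T).
Proof.
move=> oU.
pose B (i : rat * 'rV[rat]_n * nat) : set T :=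
  ball (ratr i.1.1 : R) i.2.+1%:R^-1 `*` ball (map_mx ratr i.1.2 : E) i.2.+1%:R^-1.
pose F k : set T := if unpickle k is Some i then
  (if pselect (B i `<=` U) then B i else set0) else set0.
have -> : U = \bigcup_k F k.
  apply/seteqP; split => [[t x] Utx|[t x] [k _]]; last first.
    by rewrite /F; case: unpickle => // i; case: pselect => // BU; exact: BU.
  have /nbhs_ballP[e /= e0 eU] : nbhs (t, x) U by exact: open_nbhs_nbhs.
  have [k ke] : exists k, k.+1%:R^-1 < e / 2 :> R.
    have : 0 < e / 2 by rewrite divr_gt0.
    by move=> /ltr_add_invr [k]; rewrite add0r => ?; exists k.
  have k0 : 0 < k.+1%:R^-1 :> R by rewrite invr_gt0.
  have approx (y : R) : exists r : rat, ball y k.+1%:R^-1 (ratr r).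
    have : y - k.+1%:R^-1 < y + k.+1%:R^-1 by rewrite ltrD2l gtrN.
    by move=> /rat_in_itvoo[r]; exists r; rewrite ball_itv.
  have [a ta] := approx t.
  have [c xc] : exists c : 'I_n -> rat, forall i, ball (x ord0 i) k.+1%:R^-1 (ratr (c i)).
    by have [c cP] := choice (fun i : 'I_n => approx (x ord0 i)); exists c.
  have xc' : ball x k.+1%:R^-1 (map_mx ratr (\row_i c i) : E).
    by split => // i j; rewrite (ord1 i) !mxE; exact: xc.
  have [i0 [Bi0 BU]] : exists i, B i (t, x) /\ B i `<=` U.
    exists (a, \row_i c i, k); split.
      by split; apply: ball_sym; [exact: ta|exact: xc'].
    have le : k.+1%:R^-1 + k.+1%:R^-1 <= e.
      by rewrite (splitr e) lerD// ltW.
    case=> s y [h1 h2]; apply: eU; split; apply: (le_ball le).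
      exact: ball_triangle ta h1.
    exact: ball_triangle xc' h2.
  exists (pickle i0); first exact: I.
  rewrite /F pickleK; case: pselect => // nBU; exfalso; exact: nBU.
apply: bigcupT_measurable => k; rewrite /F; case: unpickle => // i.
case: pselect => [BU|nBU] /=; last exact: measurable0.
apply: measurableX; last exact: measurable_rV_ball.
by apply: open_measurable; exact: ball_open.
Qed.

Lemma open_measurable_rV (U : set E) : open U -> measurable U.
Proof.
move=> oU; rewrite (_ : U = xsection ([set: R] `*` U : set T) 0).
  apply: measurable_xsection; apply: open_measurable_spacetime.
  rewrite (_ : _ `*` _ = snd @^-1` U); last by apply/seteqP; split=> x // [].
  by apply: open_comp => // x _; exact: cvg_snd.
by apply/seteqP; split=> x /=; rewrite /xsection/= inE//= => -[].
Qed.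

End borel_spacetime.

Section continuous_measurable.
Context {R : realType} {n : nat}.
Local Notation E := 'rV[R]_n.
Local Notation T := (measurableTypeR R * E)%type.

Lemma within_continuous_measurable (A : set T) (f : R * E -> R) :
  measurable A -> {within (A : set (R * E)), continuous f} ->
  measurable_fun A (f : T -> measurableTypeR R).
Proof.
move=> mA /continuousP cf; apply: (measurability _ (RGenOpens.measurableE R)).
move=> _ [_ [a [b ->] <-]].
have /open_subspaceP [V opV AO] := cf `]a, b[%classic ltac:(exact: interval_open).
rewrite setIC -AO; apply: measurableI => //; exact: open_measurable_spacetime.
Qed.

Lemma measurable_spacetime (D : set E) (t0 t1 : R) :
  open D -> measurable (spacetime D t0 t1 : set T).
Proof. by move=> oD; apply: measurableX => //; exact: open_measurable_rV. Qed.

End continuous_measurable.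

(** * Volume preservation in space-time *)

Section flow_map.
Context {R : realType} {d : nat}.
Local Notation E := 'rV[R]_d.
Local Notation T := (measurableTypeR R * E)%type.
Variables (D : set E) (t0 t1 : R) (g : R -> E -> E).

(** Extending by the identity outside space-time makes the map total while
keeping it volume preserving, so that image measures apply to it. *)
Definition flow_map (z : T) : T :=
  if z \in spacetime D t0 t1 then (z.1, g z.1 z.2) else z.

Lemma flow_map_in t x : t \in `[t0, t1] -> D x -> flow_map (t, x) = (t, g t x).
Proof. by move=> tI Dx; rewrite /flow_map mem_set//; split. Qed.

Hypothesis openD : open D.
Hypothesis cont_g :
  {within spacetime D t0 t1, continuous (fun z : R * E => g z.1 z.2)}.
Hypothesis gD : forall t x, t \in `[t0, t1] -> D x -> D (g t x).
Hypothesis vol_g : forall t, t \in `[t0, t1] ->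
  forall A : set E, measurable A -> A `<=` D ->
  lebesgue_rV d (D `&` g t @^-1` A) = lebesgue_rV d A.

Lemma measurable_flow_map : measurable_fun setT flow_map.
Proof.
have mS := measurable_spacetime D t0 t1 openD.
apply/measurable_fun_pairP; split.
  rewrite (_ : _ \o _ = fst); first exact: measurable_fst.
  by apply/funext => z /=; rewrite /flow_map; case: ifPn.
apply: measurable_fun_rV => i.
rewrite (_ : _ \o _ = fun z => if z \in spacetime D t0 t1
    then rV_coord i (g z.1 z.2) else rV_coord i z.2); last first.
  by apply/funext => z /=; rewrite /flow_map; case: ifPn.
apply: (measurable_fun_if measurableT) => //.
- by apply: (measurable_fun_bool true); rewrite setTI preimage_mem_true.
- rewrite setTI preimage_mem_true; apply: within_continuous_measurable => //.
  apply: within_continuous_comp cont_g => x _; exact: coord_continuous.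
- apply: measurable_funTS; apply: measurableT_comp; [exact: measurable_rV_coord|exact: measurable_snd].
Qed.

(** Each slice of [flow_map] preserves the volume of space, hence so does the
whole map for the volume of space-time. *)
Lemma flow_map_volume (A : set T) : measurable A ->
  pushforward (@lebesgue_measure R \x lebesgue_rV d)%E flow_map A
  = (@lebesgue_measure R \x lebesgue_rV d)%E A.
Proof.
move=> mA; rewrite /pushforward /= /product_measure1; apply: eq_integral => t _ /=.
have mD : measurable D by exact: open_measurable_rV.
have mB : measurable (xsection A t) by exact: measurable_xsection.
have mC : measurable (xsection (flow_map @^-1` A) t).
  apply: measurable_xsection; rewrite -[X in measurable X]setTI.
  exact: measurable_flow_map.
have [tI|tI] := boolP (t \in `[t0, t1]); last first.
  have tS x : ((t, x) \in spacetime D t0 t1) = false.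
    by apply/negbTE/negP; rewrite inE => -[/=]; rewrite (negbTE tI).
  congr (lebesgue_rV d _); apply/seteqP.
  by split => x; rewrite /xsection /= !inE /= /flow_map tS.
have CE x : D x -> xsection (flow_map @^-1` A) t x = xsection A t (g t x).
  by move=> Dx; rewrite /xsection /= !inE /= flow_map_in.
have CE' x : ~ D x -> xsection (flow_map @^-1` A) t x = xsection A t x.
  move=> Dx; rewrite /xsection /= !inE /= /flow_map memNset//.
  by case.
(* inside D the slice is moved by g t, outside D it is left in place *)
rewrite (measureDI _ mC mD) [RHS](measureDI _ mB mD).
congr (lebesgue_rV d _ + _)%E.
  by apply/seteqP; split => x [h Dx]; split => //; move: h; rewrite CE'.
have mBD : measurable (xsection A t `&` D) by exact: measurableI.
apply: etrans (vol_g t tI _ mBD _); last by move=> x [].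
congr (lebesgue_rV d _); apply/seteqP; split => x [].
  by move=> + Dx; rewrite CE// => gA; do !split => //; exact: gD.
by move=> Dx [gA _]; split => //; rewrite CE.
Qed.

Lemma restrict_flow_map (q : R -> E -> R) (z : T) :
  ((fun z => (q z.1 z.2)%:E) \_ (spacetime D t0 t1)) (flow_map z)
  = ((fun z => (q z.1 (g z.1 z.2))%:E) \_ (spacetime D t0 t1)) z.
Proof.
rewrite /patch {2}/flow_map; case: (boolP (z \in _)) => zS; last first.
  by rewrite /flow_map (negbTE zS) (negbTE zS).
rewrite /flow_map zS ifT//; case: z zS => t x /set_mem[/= tI Dx].
by apply/mem_set; split => //=; exact: gD.
Qed.

Local Notation mu := (@lebesgue_measure R \x lebesgue_rV d)%E.

(** Lagrangian and Eulerian averages of a scalar field agree. *)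
Lemma flow_integral (q : R -> E -> R) :
  spacetime_integrable D t0 t1 q ->
  spacetime_integrable D t0 t1 (fun t x => q t (g t x)) /\
  (\int[mu]_(z in spacetime D t0 t1) (q z.1 (g z.1 z.2))%:E
   = \int[mu]_(z in spacetime D t0 t1) (q z.1 z.2)%:E)%E.
Proof.
have mS := measurable_spacetime D t0 t1 openD.
move=> iq; have := (integrable_mkcond _ mS).1 iq; move: iq => _.
rewrite [in X in _ /\ X = _]integral_mkcond [in X in _ /\ _ = X]integral_mkcond.
set f := _ \_ _ => iq; set f' := _ \_ _.
have f'E : f' = f \o flow_map.
  by apply/funext => z; rewrite /f' /f /= restrict_flow_map.
have mf : measurable_fun setT f by case/integrableP: iq.
have mflow := measurable_flow_map.
have if' : mu.-integrable setT f'.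
  apply/integrableP; split; first by rewrite f'E; exact: measurableT_comp.
  have -> : (\int[mu]_z `|f' z| = \int[pushforward mu flow_map]_z `|f z|)%E.
    rewrite (ge0_integral_pushforward mflow) ?preimage_setT//; last exact: measurableT_comp.
    by apply: eq_integral => z _; rewrite f'E.
  rewrite (eq_measure_integral mu); last by move=> A mA _; exact: flow_map_volume.
  by case/integrableP: iq.
split; first exact/(integrable_mkcond _ mS).
rewrite f'E in if' *.
have -> : (\int[mu]_x (f \o flow_map) x = \int[pushforward mu flow_map]_z f z)%E.
  by rewrite (integral_pushforward mflow)// ?preimage_setT.
by apply: eq_measure_integral => A mA _; exact: flow_map_volume.
Qed.

End flow_map.

(** * Fubini's theorem on rectangles *)

Section rectangle_fubini.
Context {d1 d2 : measure_display} {T1 : measurableType d1}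
  {T2 : measurableType d2} {R : realType}.
Variables (m1 : {sigma_finite_measure set T1 -> \bar R})
  (m2 : {sigma_finite_measure set T2 -> \bar R}).
Variables (A : set T1) (B : set T2).
Hypotheses (mA : measurable A) (mB : measurable B).
Implicit Type h : T1 * T2 -> \bar R.
Local Open Scope ereal_scope.

Lemma integral_rectangle12 h :
  \int[m1]_(t in A) \int[m2]_(x in B) h (t, x)
  = \int[m1]_t fubini_F m2 (h \_ (A `*` B)) t.
Proof.
rewrite integral_mkcond; apply: eq_integral => t _.
rewrite /patch /fubini_F; case: ifPn => [tA|tA].
  rewrite [LHS]integral_mkcond; apply: eq_integral => x _.
  by rewrite /patch in_setX tA.
by rewrite integral0_eq// => x _; rewrite in_setX (negbTE tA).
Qed.

Lemma integral_rectangle21 h :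
  \int[m2]_(x in B) \int[m1]_(t in A) h (t, x)
  = \int[m2]_x fubini_G m1 (h \_ (A `*` B)) x.
Proof.
rewrite integral_mkcond; apply: eq_integral => x _.
rewrite /patch /fubini_G; case: ifPn => [xB|xB].
  rewrite [LHS]integral_mkcond; apply: eq_integral => t _.
  by rewrite /patch in_setX xB andbT.
by rewrite integral0_eq// => t _; rewrite in_setX (negbTE xB) andbF.
Qed.

Lemma fubini_G_rectangle h x : B x ->
  fubini_G m1 (h \_ (A `*` B)) x = \int[m1]_(t in A) h (t, x).
Proof.
move=> Bx; rewrite [RHS]integral_mkcond; apply: eq_integral => t _.
by rewrite /patch in_setX (mem_set Bx) andbT.
Qed.

Lemma integral_rectangle h :
  (m1 \x m2)%E.-integrable (A `*` B) h ->
  \int[m1]_(t in A) \int[m2]_(x in B) h (t, x) = \int[m1 \x m2]_(z in A `*` B) h z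
  /\ \int[m2]_(x in B) \int[m1]_(t in A) h (t, x) = \int[m1 \x m2]_(z in A `*` B) h z.
Proof.
move=> ih0; have ih := (integrable_mkcond h (measurableX mA mB)).1 ih0.
rewrite integral_rectangle12 integral_rectangle21 integral12_prod_meas1//.
by rewrite integral21_prod_meas1// -integral_mkcond.
Qed.

(** Tonelli's measurability statement, which holds also where the integral is
infinite. *)
Lemma measurable_integral_rectangle h :
  measurable_fun (A `*` B) h -> (forall z, (A `*` B) z -> 0 <= h z) ->
  measurable_fun B (fun x => \int[m1]_(t in A) h (t, x)).
Proof.
move=> mh h0.
apply: (eq_measurable_fun (fubini_G m1 (h \_ (A `*` B)))) => [x /set_mem Bx|].
  exact: fubini_G_rectangle.
apply: measurable_funTS; apply: measurable_fun_fubini_tonelli_G.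
  exact: (measurable_restrictT h (measurableX mA mB)).1 mh.
by apply: erestrict_ge0.
Qed.

(** The absolute value of the partial integral is at most the partial integral
of [`|h|], which Tonelli's theorem integrates. *)
Lemma integrable_integral_rectangle h :
  (m1 \x m2)%E.-integrable (A `*` B) h ->
  m2.-integrable B (fun x => \int[m1]_(t in A) h (t, x)).
Proof.
move=> ih; have mAB := measurableX mA mB.
have ih' := (integrable_mkcond h mAB).1 ih.
apply: (eq_integrable mB (fubini_G m1 (h \_ (A `*` B)))) => [x /set_mem Bx|].
  exact: fubini_G_rectangle.
apply: (@integrableS _ _ _ _ setT) => //.
set f := h \_ (A `*` B) in ih' *.
have mf : measurable_fun setT f by case/integrableP: ih'.
apply/integrableP; split; first exact: (measurable_fubini_G (m2 := m2) ih').
have mabs : measurable_fun setT (abse \o f) by exact: measurableT_comp.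
have abs0 z : 0 <= (abse \o f) z by exact: abse_ge0.
apply: (@le_lt_trans _ _ (\int[m2]_x fubini_G m1 (abse \o f) x)); last first.
  rewrite -(fubini_tonelli2 (m1 := m1) (m2 := m2) _ mabs abs0).
  by case/integrableP: ih'.
apply: ge0_le_integral => //.
- by apply: measurableT_comp => //; exact: (measurable_fubini_G (m2 := m2) ih').
- exact: measurable_fun_fubini_tonelli_G mabs abs0.
- move=> x _; apply: le_abse_integral => //.
  exact: measurableT_comp.
Qed.

End rectangle_fubini.

(** * Integrals of extended real functions without integrability *)

Section extended_integrals.
Context {dd : measure_display} {T : measurableType dd} {R : realType}.
Variables (mu : {measure set T -> \bar R}) (D : set T).
Hypothesis mD : measurable D.
Implicit Types f g : T -> \bar R.
Local Open Scope ereal_scope.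

Lemma le_integral_measurable f g :
  measurable_fun D f -> measurable_fun D g -> (forall x, D x -> f x <= g x) ->
  \int[mu]_(x in D) f x <= \int[mu]_(x in D) g x.
Proof.
move=> mf mg fg; rewrite integralE [leRHS]integralE; apply: leeB.
  apply: ge0_le_integral => //; [exact: measurable_funepos|exact: measurable_funepos|].
  by move=> x Dx; apply: (@funepos_le _ _ D); [move=> y /set_mem; exact: fg|exact: mem_set].
apply: ge0_le_integral => //; [exact: measurable_funeneg|exact: measurable_funeneg|].
by move=> x Dx; apply: (@funeneg_le _ _ D); [move=> y /set_mem; exact: fg|exact: mem_set].
Qed.

Lemma le_combination_shift (l m : R) (a b x y z : \bar R) :
  a \is a fin_num -> b \is a fin_num -> l%:E * x + m%:E * y <= z ->
  l%:E * (a + x) + m%:E * (b + y) <= l%:E * a + m%:E * b + z.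
Proof.
move=> fa fb xyz.
rewrite (muleDr _ (fin_num_adde_defr _ fa))// (muleDr _ (fin_num_adde_defr _ fb))//.
by rewrite addeACA; apply: leeD.
Qed.

Lemma integral_funeneg_lty f : \int[mu]_(x in D) f x != -oo ->
  \int[mu]_(x in D) f^\- x < +oo.
Proof.
rewrite integralE; apply: contraNT; rewrite -leNgt leye_eq => /eqP ->.
by rewrite addeC.
Qed.

Lemma maxeN_addr (a b : \bar R) : a != +oo -> b != +oo ->
  maxe (- (a + b)) 0 <= maxe (- a) 0 + maxe (- b) 0.
Proof.
move=> aoo boo; rewrite ge_max; apply/andP; split.
  rewrite oppeD; first by apply: leeD; rewrite le_max lexx.
  by move: a b aoo boo => [?||] [?||].
by apply: adde_ge0; rewrite le_max lexx orbT.
Qed.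

(** The identity [h^+ + f^- + g^- = h^- + f^+ + g^+] for [h = f + g]: a form of
[h = f + g] between nonnegative quantities, which can be integrated term by
term even where some of them are infinite. *)
Lemma maxe_balance (a b : \bar R) : a != +oo -> b != +oo ->
  maxe (a + b) 0 + (maxe (- a) 0 + maxe (- b) 0)
  = maxe (- (a + b)) 0 + (maxe a 0 + maxe b 0).
Proof.
have ge0 (x : \bar R) : maxe x 0 != -oo.
  by rewrite gt_eqF// (lt_le_trans (ltNyr 0))// le_max lexx orbT.
have maxy : maxe (+oo : \bar R) 0 = +oo by rewrite max_l// leey.
move: a b => [a||] [b||] // _ _; rewrite ?(addNye, addeNy) //= ?maxy.
- have maxB (r : R) : (Num.max r 0 - Num.max (- r) 0 = r)%R.
    by rewrite /Num.max oppr_lt0; case: ltgtP => ?; lra.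
  rewrite -!EFinD -!EFin_max -!EFinD; congr EFin.
  have := maxB a; have := maxB b; have := maxB (a + b)%R; lra.
- by rewrite !addye ?addey ?adde_eq_ninfty ?negb_or ?ge0.
- by rewrite !addye ?addey ?adde_eq_ninfty ?negb_or ?ge0.
- by rewrite !addye ?addey ?adde_eq_ninfty ?negb_or ?ge0.
Qed.

(** With the convention [+oo - oo = -oo] the integral is superadditive on all
measurable functions that avoid [+oo]: if neither integral on the left is [-oo],
the negative parts have finite integrals and the balance of positive and
negative parts can be solved for the integral of the sum. *)
Lemma le_integralD f g : measurable_fun D f -> measurable_fun D g ->
  (forall x, D x -> f x != +oo) -> (forall x, D x -> g x != +oo) ->
  \int[mu]_(x in D) f x + \int[mu]_(x in D) g x
  <= \int[mu]_(x in D) (f x + g x).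
Proof.
move=> mf mg foo goo.
have [->|fN] := eqVneq (\int[mu]_(x in D) f x) -oo; first by rewrite addNye leNye.
have [->|gN] := eqVneq (\int[mu]_(x in D) g x) -oo; first by rewrite addeNy leNye.
have fneg := integral_funeneg_lty _ fN; have gneg := integral_funeneg_lty _ gN.
pose h x := f x + g x.
have mh : measurable_fun D h by exact: emeasurable_funD.
have mp (k : T -> \bar R) : measurable_fun D k -> measurable_fun D k^\+ by exact: measurable_funepos.
have mn (k : T -> \bar R) : measurable_fun D k -> measurable_fun D k^\- by exact: measurable_funeneg.
have hneg : \int[mu]_(x in D) h^\- x <= \int[mu]_(x in D) f^\- x + \int[mu]_(x in D) g^\- x.
  rewrite -ge0_integralD//; [|exact: mn|exact: mn].
  apply: ge0_le_integral => //; [exact: mn|by apply: emeasurable_funD; exact: mn|].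
  by move=> x Dx; rewrite !funeneg.unlock; exact: (maxeN_addr _ _ (foo x Dx) (goo x Dx)).
have bal : \int[mu]_(x in D) h^\+ x + (\int[mu]_(x in D) f^\- x + \int[mu]_(x in D) g^\- x)
    = \int[mu]_(x in D) h^\- x + (\int[mu]_(x in D) f^\+ x + \int[mu]_(x in D) g^\+ x).
  rewrite -!ge0_integralD//; try by [exact: mp|exact: mn|apply: emeasurable_funD; [exact: mp|exact: mp]|apply: emeasurable_funD; [exact: mn|exact: mn]|move=> x _; exact: adde_ge0].
  by apply: eq_integral => x /set_mem Dx; rewrite !funepos.unlock !funeneg.unlock; exact: (maxe_balance _ _ (foo x Dx) (goo x Dx)).
have hneg' : \int[mu]_(x in D) h^\- x < +oo.
  exact: le_lt_trans hneg (lte_add_pinfty fneg gneg).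
have ge0 (k : T -> \bar R) : (forall x, 0 <= k x) -> 0 <= \int[mu]_(x in D) k x.
  by move=> k0; exact: integral_ge0.
rewrite integralE [X in _ + X]integralE [leRHS]integralE.
move: bal hneg' fneg gneg.
move: (ge0 _ (funepos_ge0 h)) (ge0 _ (funeneg_ge0 h)) (ge0 _ (funepos_ge0 f)).
move: (ge0 _ (funeneg_ge0 f)) (ge0 _ (funepos_ge0 g)) (ge0 _ (funeneg_ge0 g)).
rewrite -/h.
move: (\int[mu]_(x in D) h^\+ x) (\int[mu]_(x in D) h^\- x) => hp hn.
move: (\int[mu]_(x in D) f^\+ x) (\int[mu]_(x in D) f^\- x) => fp fn.
move: (\int[mu]_(x in D) g^\+ x) (\int[mu]_(x in D) g^\- x) => gp gn.
case: hp => [hp||] //; case: hn => [hn||] //; case: fp => [fp||] //;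
case: fn => [fn||] //; case: gp => [gp||] //; case: gn => [gn||] // _ _ _ _ _ _ e _ _ _ //=.
move: e => [e]; rewrite -?EFinN -?EFinD lee_fin; lra.
Qed.

Lemma integralZl_measurable (l : R) f : measurable_fun D f -> (0 < l)%R ->
  \int[mu]_(x in D) (l%:E * f x) = l%:E * \int[mu]_(x in D) f x.
Proof.
move=> mf l0; rewrite integralE [in RHS]integralE.
have -> : \int[mu]_(x in D) (fun x => l%:E * f x)^\+ x = l%:E * \int[mu]_(x in D) f^\+ x.
  rewrite -ge0_integralZl//; [|exact: measurable_funepos|exact: ltW].
  by apply: eq_integral => x _; rewrite (@ge0_funeposM _ _ l f (ltW l0)).
have -> : \int[mu]_(x in D) (fun x => l%:E * f x)^\- x = l%:E * \int[mu]_(x in D) f^\- x.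
  rewrite -ge0_integralZl//; [|exact: measurable_funeneg|exact: ltW].
  by apply: eq_integral => x _; rewrite (@ge0_funenegM _ _ l f (ltW l0)).
have := integral_ge0 mu (fun x (_ : D x) => funepos_ge0 f x).
have := integral_ge0 mu (fun x (_ : D x) => funeneg_ge0 f x).
move: (\int[mu]_(x in D) f^\+ x) (\int[mu]_(x in D) f^\- x) => [a||] // [b||] // _ _.
- by rewrite -?EFinN -?EFinM -?EFinN -?EFinD mulrBr.
- by rewrite /= !gt0_muley ?lte_fin//= gt0_muleNy ?lte_fin.
- by rewrite /= !gt0_muley ?lte_fin.
- by rewrite /= !gt0_muley ?lte_fin//= gt0_muleNy ?lte_fin.
Qed.

End extended_integrals.

(** * Curves and limits *)

Lemma cvg_sum_seq {R : realType} {T I : Type} (F : set_system T) {FF : Filter F}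
    (r : seq I) (f : I -> T -> R) (l : I -> R) :
  (forall i, f i x @[x --> F] --> l i) ->
  \sum_(i <- r) f i x @[x --> F] --> \sum_(i <- r) l i.
Proof.
move=> fl; elim: r => [|i r IH].
  by under eq_fun do rewrite big_nil; rewrite big_nil; exact: cvg_cst.
by under eq_fun do rewrite big_cons; rewrite big_cons; exact: cvgD.
Qed.

Section curves_calculus.
Context {R : realType} {d : nat}.
Local Notation E := 'rV[R]_d.
Implicit Types (z : R -> E) (U : set R).

Lemma sqnorm_continuous : continuous (@sqnorm R d).
Proof.
move=> v; apply: (cvg_sum_seq (nbhs v)) => i.
by under eq_fun do rewrite expr2; rewrite expr2; apply: cvgM; exact: coord_continuous.
Qed.

Lemma sqnorm_ge0 (v : E) : 0 <= sqnorm v.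
Proof. by apply: sumr_ge0 => i _; exact: sqr_ge0. Qed.

Lemma class_C1_derivable U z t :
  class_C 1 U (z : R^o -> E) -> U t -> derivable z t 1.
Proof. by move=> [dz _] Ut; apply/derivable1_diffP; exact: dz. Qed.

Lemma class_C1_continuous U z t :
  class_C 1 U (z : R^o -> E) -> U t -> {for t, continuous z}.
Proof. by move=> [dz _] Ut; exact: differentiable_continuous (dz _ Ut). Qed.

Lemma class_C1_continuous_derive1 U z t :
  class_C 1 U (z : R^o -> E) -> U t -> {for t, continuous (derive1 z)}.
Proof.
move=> [_ cz] Ut; rewrite (_ : derive1 z = fun t => 'D_1 (z : R^o -> E) t).
  by apply: (cz 1); exact: mem_set.
by apply/funext => s; rewrite derive1E.
Qed.

Lemma is_derive_affine (c : E) (b s t v : R) :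
  is_derive t v ((fun u => (b * (u - s)) *: c) : R^o -> E) ((b * v) *: c).
Proof.
have cv : h^-1 *: ((b * (h *: v + t - s)) *: c - (b * (t - s)) *: c) @[h --> 0^']
    --> (b * v) *: c.
  apply: cvg_near_cst; near=> h.
  have h0 : h != 0 by near: h; exact: nbhs_dnbhs_neq.
  rewrite -scalerBl scalerA; congr (_ *: _).
  rewrite /GRing.scale/=; field.
  exact: h0.
by split; [apply/cvg_ex; exists ((b * v) *: c)|exact: cvg_lim cv].
Unshelve. all: by end_near. Qed.

(** Adding an affine function of time keeps a curve continuously
differentiable; this is the perturbation that moves its two end points. *)
Lemma class_C1_shift U z (a c : E) (b s : R) : open U ->
  class_C 1 U (z : R^o -> E) ->
  class_C 1 U ((fun t => z t + a + (b * (t - s)) *: c) : R^o -> E) /\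
  (forall t, U t -> derive1 (fun t => z t + a + (b * (t - s)) *: c) t = derive1 z t + b *: c).
Proof.
move=> oU Cz; set y := (X in class_C 1 U X).
have dy t v : U t -> is_derive t v (y : R^o -> E) ('D_v (z : R^o -> E) t + (b * v) *: c).
  move=> Ut.
  have dz : is_derive t v (z : R^o -> E) ('D_v (z : R^o -> E) t).
    by apply: derivableP; apply: diff_derivable; exact: (Cz.1 t Ut).
  have -> : y = (z : R^o -> E) + cst a + (fun u : R^o => (b * (u - s)) *: c) by [].
  apply: is_deriveD; last exact: is_derive_affine.
  rewrite -['D_v _ _]addr0; exact: is_deriveD.
split; last first.
  by move=> t Ut; rewrite !derive1E (derive_val (is_derive := dy t 1 Ut)) mulr1.
split=> [t Ut|v t /set_mem Ut].
  by apply/derivable1_diffP; exact: (ex_derive (is_derive := dy t 1 Ut)).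
have cz : {in U, continuous (fun x => 'D_v (z : R^o -> E) x)} := Cz.2 v.
have cv : {for t, continuous (fun x => 'D_v (z : R^o -> E) x + (b * v) *: c)}.
  by apply: continuousD; [exact: cz (mem_set Ut)|exact: cst_continuous].
rewrite /continuous_at (derive_val (is_derive := dy t v Ut)).
apply: cvg_trans cv; apply: near_eq_cvg; near=> u.
have Uu : U u by near: u; exact: (open_nbhs_nbhs (conj oU Ut)).
by rewrite (derive_val (is_derive := dy u v Uu)).
Unshelve. all: by end_near. Qed.

Lemma convex_segment (D : set E) (x y : E) (s : R) :
  convex_set (D : set (convex_lmodType E)) -> D x -> D y -> 0 <= s <= 1 ->
  D (x + s *: (y - x)).
Proof.
move=> cD Dx Dy /andP[s0 s1]; apply/set_mem.
have := cD y x (Itv01 s0 s1) (mem_set Dy) (mem_set Dx).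
rewrite (_ : x + _ = s *: y + (1 - s) *: x); first by [].
by rewrite scalerBl scale1r scalerBr addrCA.
Qed.

End curves_calculus.

Section filter_facts.

(** Composition of limits when the outer function is continuous only relative
to [A]: the inner map has to stay in [A]. *)
Lemma within_continuous_cvg {T S : topologicalType} (A : set T) (f : T -> S)
    {I : Type} (F : set_system I) {FF : Filter F} (u : I -> T) (x : T) :
  {within A, continuous f} -> A x -> u @ F --> x -> (\forall i \near F, A (u i)) ->
  f (u i) @[i --> F] --> f x.
Proof.
move=> /subspace_continuousP cf Ax ux Au.
apply: cvg_comp (cf x Ax) => B; rewrite /= /within /nbhs/= => wB.
have := ux _ wB; rewrite /nbhs/= => h.
near=> i; have hi : A (u i) -> B (u i) by near: i; exact: h.
apply: hi; near: i; exact: Au.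
Unshelve. all: by end_near. Qed.

Lemma cvg_to_pair {S T : topologicalType} {I : Type} (F : set_system I)
    {FF : Filter F} (u : I -> S) (v : I -> T) (a : S) (b : T) :
  u @ F --> a -> v @ F --> b -> (u i, v i) @[i --> F] --> (a, b).
Proof. by move=> ua vb; exact: (cvg_pair ua vb). Qed.

End filter_facts.

(** * The action and its infimum *)

Section actions.
Context {R : realType} {d : nat}.
Local Notation E := 'rV[R]_d.
Variables (D : set E) (t0 t1 : R).
Hypotheses (openD : open D) (t01 : t0 < t1).
Implicit Types (q : R -> E -> R) (z : R -> E).

Local Notation leb := (@lebesgue_measure R).
Local Notation I := (`[t0, t1]%classic : set R).

Definition continuous_field q :=
  {within spacetime D t0 t1, continuous (fun z : R * E => q z.1 z.2 : R)}.

Definition lagrangian q z (t : R) : R := - q t (z t) + sqnorm (derive1 z t) / 2.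

Lemma potential_continuous q z x y :
  continuous_field q -> curves D t0 t1 x y z ->
  {within I, continuous (fun t => q t (z t))}.
Proof.
move=> cq [[U [oU IU Cz]] zD _ _]; apply/subspace_continuousP => t It.
apply: (within_continuous_cvg (spacetime D t0 t1)
  (fun w : R * E => q w.1 w.2) _ (fun s => (s, z s)) (t, z t) cq).
- by split => //=; exact: zD.
- apply: cvg_within_filter; apply: cvg_to_pair; first exact: cvg_id.
  exact: class_C1_continuous Cz (IU _ It).
- by near=> s; split => /=; [|apply: zD]; near: s; exact: withinT.
Unshelve. all: by end_near. Qed.

Lemma kinetic_continuous z x y : curves D t0 t1 x y z ->
  {within I, continuous (fun t => sqnorm (derive1 z t) / 2)}.
Proof.
move=> [[U [oU IU Cz]] zD _ _]; apply/subspace_continuousP => t It.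
apply: cvgMr_tmp; apply: cvg_within_filter.
apply: continuous_cvg; first exact: sqnorm_continuous.
exact: class_C1_continuous_derive1 Cz (IU _ It).
Qed.

Lemma lagrangian_continuous q z x y :
  continuous_field q -> curves D t0 t1 x y z ->
  {within I, continuous (lagrangian q z)}.
Proof.
move=> cq cz; apply/subspace_continuousP => t It; apply: cvgD.
  apply: cvgN; exact: (subspace_continuousP _ _).1 (potential_continuous q z x y cq cz) t It.
exact: (subspace_continuousP _ _).1 (kinetic_continuous z x y cz) t It.
Qed.

Lemma continuous_integrable (f : R -> R) :
  {within I, continuous f} -> leb.-integrable I (EFin \o f).
Proof. by move=> cf; apply: continuous_compact_integrable => //; exact: segment_compact. Qed.

Lemma continuous_integralE (f : R -> R) : {within I, continuous f} ->
  (\int[leb]_(t in I) (f t)%:E)%E = (\int[leb]_(t in I) f t)%:E.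
Proof.
move=> cf; rewrite /Rintegral fineK//; apply: integrable_fin_num => //.
exact: continuous_integrable.
Qed.

Lemma lagrangian_integrable q z x y :
  continuous_field q -> curves D t0 t1 x y z ->
  leb.-integrable I (EFin \o lagrangian q z).
Proof.
move=> cq cz; apply: continuous_integrable.
exact: lagrangian_continuous cq cz.
Qed.

Lemma actionE q z x y : continuous_field q -> curves D t0 t1 x y z ->
  action t0 t1 q z = (\int[leb]_(t in I) lagrangian q z t)%:E.
Proof.
by move=> cq cz; apply: continuous_integralE; exact: lagrangian_continuous cq cz.
Qed.

Lemma J_le_action q z x y : curves D t0 t1 x y z ->
  (J D t0 t1 q x y <= action t0 t1 q z)%E.
Proof. by move=> cz; apply: ereal_inf_lbound; exists z. Qed.

(** The action of a fixed curve is affine in the potential, and an infimum of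
affine functions is concave. *)
Lemma J_concave q1 q2 (l : R) x y :
  continuous_field q1 -> continuous_field q2 -> 0 <= l <= 1 ->
  (l%:E * J D t0 t1 q1 x y + (1 - l)%:E * J D t0 t1 q2 x y
   <= J D t0 t1 (fun t x => (l * q1 t x + (1 - l) * q2 t x)%R) x y)%E.
Proof.
move=> c1 c2 /andP[l0 l1]; apply: le_ereal_inf_tmp => _ [z cz <-].
have i1 := lagrangian_integrable _ _ _ _ c1 cz.
have i2 := lagrangian_integrable _ _ _ _ c2 cz.
have -> : action t0 t1 (fun t x => (l * q1 t x + (1 - l) * q2 t x)%R) z
    = (l%:E * action t0 t1 q1 z + (1 - l)%:E * action t0 t1 q2 z)%E.
  rewrite -!integralZl// -integralD//; try exact: integrableZl.
  by apply: eq_integral => t _; rewrite -!EFinM -EFinD; congr EFin; lra.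
by apply: leeD; apply: lee_wpmul2l; rewrite ?lee_fin ?subr_ge0//; exact: J_le_action.
Qed.

Lemma action_split q z x y : continuous_field q -> curves D t0 t1 x y z ->
  (action t0 t1 q z = (- (\int[leb]_(t in I) q t (z t)))%:E
    + (\int[leb]_(t in I) (sqnorm (derive1 z t) / 2))%:E)%E.
Proof.
move=> cq cz; rewrite (actionE q z x y cq cz) -EFinD; congr EFin.
have mI : measurable (I : set (measurableTypeR R)) by exact: measurable_itv.
have ip := continuous_integrable _ (potential_continuous q z x y cq cz).
have ik := continuous_integrable _ (kinetic_continuous z x y cz).
have -> : - (\int[leb]_(t in I) q t (z t)) = \int[leb]_(t in I) (- q t (z t)).
  rewrite -mulN1r -(RintegralZl _ mI ip); apply: eq_Rintegral => t _.
  by rewrite mulN1r.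
rewrite -(RintegralD mI) //.
have -> : EFin \o (fun t => - q t (z t)) = (\- (EFin \o (fun t => q t (z t))))%E by [].
exact: integrableN.
Qed.

(** [z] plus the affine function of time that moves its end points from [x] and
[y] to [w.1] and [w.2]; it vanishes when [w = (x, y)]. *)
Definition shifted_curve z (x y : E) (w : E * E) (t : R) : E :=
  z t + (w.1 - x) + ((t1 - t0)^-1 * (t - t0)) *: ((w.2 - y) - (w.1 - x)).

Lemma curves_shifted_curve z x y w : curves D t0 t1 x y z ->
  (forall t, t \in `[t0, t1] -> D (shifted_curve z x y w t)) ->
  curves D t0 t1 w.1 w.2 (shifted_curve z x y w) /\
  (forall t, t \in `[t0, t1] -> derive1 (shifted_curve z x y w) t
     = derive1 z t + (t1 - t0)^-1 *: ((w.2 - y) - (w.1 - x))).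
Proof.
move=> [[U [oU IU Cz]] zD zx zy] wD.
have [Cw dw] := class_C1_shift U z (w.1 - x) ((w.2 - y) - (w.1 - x)) (t1 - t0)^-1 t0 oU Cz.
split; last by move=> t It; apply: dw; exact: IU.
split => //; first by exists U.
  by rewrite /shifted_curve zx subrr mulr0 scale0r addr0 addrC subrK.
rewrite /shifted_curve zy mulVf ?subr_eq0 ?gt_eqF// scale1r.
by rewrite -addrA [w.1 - x + _]addrC subrK addrC subrK.
Qed.

(** Take a curve whose action is below [a].  On the compact time interval the
Lagrangian of the shifted curve is, uniformly in time, less than [e] above that of
the original one once the end points are close enough, and the shifted curve
stays in the open set [D]. *)
Lemma J_upper_semicontinuous q x y (a : R) : continuous_field q -> 
  (J D t0 t1 q x y < a%:E)%E ->
  \forall w \near ((x, y) : E * E), (J D t0 t1 q w.1 w.2 < a%:E)%E.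
Proof.
move=> cq /ereal_inf_ltP[_ [z cz <-]]; rewrite (actionE _ _ _ _ cq cz) lte_fin => za.
(* half of the room below a, spread over the time interval *)
pose e := (a - \int[leb]_(t in I) lagrangian q z t) / (2 * (t1 - t0)).
have e0 : 0 < e by rewrite divr_gt0 ?subr_gt0// mulr_gt0 ?subr_gt0.
have [[U [oU IU Cz]] zD zx zy] := cz.
pose L (w : E * E) (t : R) : R := - q t (shifted_curve z x y w t)
  + sqnorm (derive1 z t + (t1 - t0)^-1 *: ((w.2 - y) - (w.1 - x))) / 2.
pose P (w : E * E) (t : R) := t \in `[t0, t1] -> D (shifted_curve z x y w t) /\
  L w t < lagrangian q z t + e.
have ie : leb.-integrable I (EFin \o cst e).
  apply: continuous_compact_integrable; first exact: segment_compact.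
  by apply: continuous_subspaceT; exact: cst_continuous.
have near_w : \forall w \near nbhs ((x, y) : E * E), I `<=` P w.
  have cov : near_covering I := (compact_near_coveringP I).1 (@segment_compact R t0 t1).
  apply: (cov (E * E)%type (nbhs ((x, y) : E * E)) P) => t It.
  have sh0 s : shifted_curve z x y (x, y) s = z s.
    by rewrite /shifted_curve /= !subrr scaler0 !addr0.
  pose N := nbhs ((t, (x, y)) : R * (E * E)).
  have c1 : p.1 @[p --> N] --> t by exact: cvg_fst.
  have c21 : p.2.1 @[p --> N] --> x 
    by apply: (@cvg_comp _ _ _ snd fst N (nbhs ((x, y) : E * E)) (nbhs x)); [exact: cvg_snd|exact: cvg_fst].
  have c22 : p.2.2 @[p --> N] --> y 
    by apply: (@cvg_comp _ _ _ snd snd N (nbhs ((x, y) : E * E)) (nbhs y)); [exact: cvg_snd|exact: cvg_snd].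
  have cdiff : p.2.2 - y - (p.2.1 - x) @[p --> N] --> y - y - (x - x).
    by apply: cvgB; apply: cvgB => //; exact: cvg_cst.
  have cz1 : z p.1 @[p --> N] --> z t.
    apply: continuous_cvg c1; exact: class_C1_continuous Cz (IU _ It).
  have csh : shifted_curve z x y p.2 p.1 @[p --> N] --> z t.
    rewrite -(sh0 t); apply: cvgD.
      by apply: cvgD => //; apply: cvgB => //; exact: cvg_cst.
    apply: cvgZ => //; apply: cvgMl_tmp; apply: cvgB => //; exact: cvg_cst.
  have cdz : derive1 z p.1 @[p --> N] --> derive1 z t.
    apply: continuous_cvg c1; exact: class_C1_continuous_derive1 Cz (IU _ It).
  have cdsh : derive1 z p.1 + (t1 - t0)^-1 *: (p.2.2 - y - (p.2.1 - x)) @[p --> N] --> derive1 z t.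
    have : derive1 z p.1 + (t1 - t0)^-1 *: (p.2.2 - y - (p.2.1 - x)) @[p --> N]
        --> derive1 z t + (t1 - t0)^-1 *: (y - y - (x - x)).
      by apply: cvgD => //; apply: cvgZ => //; exact: cvg_cst.
    by rewrite !subrr scaler0 addr0.
  have nD : \forall p \near N, D (shifted_curve z x y p.2 p.1).
    by apply: csh; apply: open_nbhs_nbhs; split => //; exact: zD.
  (* q is continuous only relative to space-time: restrict to times in I *)
  pose W := within (fun p : R * (E * E) => I p.1) N.
  have WN T (f : R * (E * E) -> T) (l : set_system T) : f @ N --> l -> f @ W --> l.
    exact: cvg_within_filter.
  have cL : L p.2 p.1 @[p --> W] --> lagrangian q z t.
    apply: cvgD.
      apply: cvgN; apply: (within_continuous_cvg (spacetime D t0 t1)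
        (fun v : R * E => q v.1 v.2) _ (fun p : R * (E * E) => (p.1, shifted_curve z x y p.2 p.1)) (t, z t) cq).
      - by split => //=; exact: zD.
      - by apply: cvg_to_pair; apply: WN.
      - near=> p; split => /=; first by near: p; exact: withinT.
        by near: p; apply: cvg_within.
    apply: cvgMr_tmp; apply: continuous_cvg; first exact: sqnorm_continuous.
    exact: WN.
  have cl : lagrangian q z p.1 @[p --> W] --> lagrangian q z t.
    apply: (within_continuous_cvg I (lagrangian q z) _ (fun p : R * (E * E) => p.1) t).
    + exact: lagrangian_continuous cq cz.
    + exact: It.
    + exact: WN.
    + exact: withinT.
  have : \forall p \near W, 0 < lagrangian q z p.1 - L p.2 p.1 + e.
    have cLl : lagrangian q z p.1 - L p.2 p.1 + e @[p --> W]
        --> lagrangian q z t - lagrangian q z t + e.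
      by apply: cvgD; [exact: cvgB|exact: cvg_cst].
    by apply: (cvgr_gt _ cLl); rewrite subrr add0r.
  move=> nW.
  have : \forall p \near N, I p.1 -> D (shifted_curve z x y p.2 p.1) /\ L p.2 p.1 < lagrangian q z p.1 + e.
    near=> p => Ip; split; first by near: p.
    have : 0 < lagrangian q z p.1 - L p.2 p.1 + e by move: Ip; near: p; exact: nW.
    lra.
  by [].
near=> w.
have hw : forall t, t \in `[t0, t1] -> D (shifted_curve z x y w t) /\ L w t < lagrangian q z t + e.
  by move=> t It; apply: (near near_w w _) => //.
have [cw dw] := curves_shifted_curve _ _ _ w cz (fun t It => (hw t It).1).
apply: le_lt_trans (J_le_action q _ _ _ cw) _.
rewrite (actionE _ _ _ _ cq cw) lte_fin.
apply: (@le_lt_trans _ _ (\int[leb]_(t in I) (lagrangian q z t + e))).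
  apply: le_Rintegral => //.
  - exact: lagrangian_integrable cq cw.
  - rewrite (_ : _ \o _ = (EFin \o lagrangian q z) \+ (EFin \o cst e))%E//.
    by apply: integrableD => //; exact: lagrangian_integrable cq cz.
  - move=> t It; have [_ /ltW] := hw t It; rewrite /L -dw//.
rewrite RintegralD//; last exact: lagrangian_integrable cq cz.
rewrite Rintegral_cst//.
have mI : fine (leb I) = t1 - t0.
  by rewrite lebesgue_measure_itv/= lte_fin t01/=.
rewrite (_ : fine _ = t1 - t0); last exact: mI.
set A := \int[leb]_(t in I) _; have -> : e * (t1 - t0) = (a - A) / 2.
  by rewrite /e -/A; field; rewrite subr_eq0 gt_eqF.
by move: za; rewrite -/A; lra.
Unshelve. all: by end_near. Qed.

End actions.

(** * Derivatives along lines and second order bounds *)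

Section line_derivatives.
Context {R : realType} {V W : normedModType R}.
Implicit Types (f : V -> W) (a h : V).

Let line_quotient f a h (s v : R) :
  (fun k : R => k^-1 *: (((fun u : R^o => f (a + u *: h)) \o shift (s : R^o)) (k *: v)
     - f (a + s *: h)))
  = (fun k : R => k^-1 *: ((f \o shift (a + s *: h)) (k *: (v *: h)) - f (a + s *: h))).
Proof.
apply/funext => k; congr (_ *: (f _ - _)).
by rewrite /= scalerDl scalerA [RHS]addrC -addrA [_ + s *: h]addrC.
Qed.

Lemma derive_line f a h (s v : R) :
  'D_v (fun u : R^o => f (a + u *: h)) s = 'D_(v *: h) f (a + s *: h).
Proof. by rewrite /derive line_quotient. Qed.

Lemma derivable_line f a h (s v : R) :
  derivable f (a + s *: h) (v *: h) ->
  derivable (fun u : R^o => f (a + u *: h)) s v.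
Proof. by rewrite /derivable line_quotient. Qed.

Lemma is_derive_line f a h (s : R) : differentiable f (a + s *: h) ->
  is_derive s 1 (fun u : R^o => f (a + u *: h)) ('D_h f (a + s *: h)).
Proof.
move=> df; split; first by apply: derivable_line; exact: diff_derivable.
by rewrite derive_line scale1r.
Qed.

End line_derivatives.

Section taylor.
Context {R : realType}.

(** The mean value theorem is applied to [phi1] and then to
[phi s - phi1 0 * s - c / 2 * s ^ 2]. *)
Lemma taylor2_le (phi phi1 phi2 : R -> R) (c : R) :
  (forall s, 0 <= s <= 1 -> is_derive (s : R) 1 phi (phi1 s)) ->
  (forall s, 0 <= s <= 1 -> is_derive (s : R) 1 phi1 (phi2 s)) ->
  (forall s, 0 <= s <= 1 -> phi2 s <= c) ->
  phi 1 <= phi 0 + phi1 0 + c / 2.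
Proof.
move=> d1 d2 hc.
have slope s : 0 < s <= 1 -> phi1 s - phi1 0 <= c * s.
  move=> /andP[s0 s1].
  have sub u : u \in `[0, s] -> 0 <= u <= 1.
    by rewrite in_itv/= => /andP[-> /le_trans ->].
  have [||xi /subset_itv_oo_cc /sub xi01 ->] := @MVT R phi1 phi2 0 s s0.
  - by move=> x /subset_itv_oo_cc /sub; exact: d2.
  - apply: derivable_within_continuous => x /sub x01.
    by have [] := d2 x x01.
  - by rewrite subr0 ler_wpM2r ?(ltW s0)// hc.
pose psi s := phi s - phi1 0 * s - c / 2 * s ^+ 2.
have dpsi s : 0 <= s <= 1 -> is_derive (s : R) 1 psi (phi1 s - phi1 0 - c * s).
  move=> s01; have := d1 s s01 => ds.
  have -> : psi = (phi : R^o -> R^o) - (phi1 0 \*: id) - (c / 2 \*: (id ^+ 2)).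
    by apply/funext => u.
  apply: is_derive_eq.
  rewrite /GRing.scale /=; lra.
have [|||xi xi01] := @MVT R psi (fun s => phi1 s - phi1 0 - c * s) 0 1.
- by [].
- by move=> x /subset_itv_oo_cc; rewrite in_itv; exact: dpsi.
- apply: derivable_within_continuous => x; rewrite in_itv => x01.
  by have [] := dpsi x x01.
have := slope xi; move: xi01; rewrite in_itv/= => /andP[xi0 xi1].
rewrite xi0 (ltW xi1) => /(_ isT) h; rewrite /psi => e; move: h e.
rewrite !mulr1 !mulr0 subr0 expr1n expr0n/= mulr0 !subr0; lra.
Qed.

End taylor.

Section spacetime_derivatives.
Context {R : realType} {d : nat}.
Local Notation E := 'rV[R]_d.

(** Partial derivatives are directional derivatives in space-time: the two
difference quotients are the same function. *)
Lemma derive_space {W : normedModType R} (f : R * E -> W) (t : R) (v x : E) :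
  'D_v (fun y => f (t, y)) x = 'D_((0, v) : R * E) f (t, x).
Proof.
rewrite /derive (_ : (fun k : R => _) = (fun k : R =>
  k^-1 *: ((f \o shift (t, x)) (k *: ((0, v) : R * E)) - f (t, x))))//.
apply/funext => k; congr (_ *: (f _ - _)).
by apply: (f_equal2 (@pair R E)); rewrite /= ?scaler0 ?add0r.
Qed.

Let time_quotient {W : normedModType R} (f : R * E -> W) (t v : R) (x : E) :
  (fun k : R => k^-1 *: (((fun s : R^o => f (s, x)) \o shift (t : R^o)) (k *: v) - f (t, x)))
  = (fun k : R => k^-1 *: ((f \o shift (t, x)) (k *: ((v, 0) : R * E)) - f (t, x))).
Proof.
apply/funext => k; congr (_ *: (f _ - _)).
by apply: (f_equal2 (@pair R E)); rewrite /= ?scaler0 ?add0r.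
Qed.

Lemma derive_time {W : normedModType R} (f : R * E -> W) (t v : R) (x : E) :
  'D_v (fun s : R^o => f (s, x)) t = 'D_((v, 0) : R * E) f (t, x).
Proof. by rewrite /derive time_quotient. Qed.

Lemma derivable_time {W : normedModType R} (f : R * E -> W) (t : R) (x : E) :
  differentiable f (t, x) -> derivable (fun s : R^o => f (s, x)) t 1.
Proof.
by rewrite /derivable time_quotient => df; exact: diff_derivable.
Qed.

Local Notation e_ i := ((0, delta_mx ord0 i) : R * E).

Lemma derive_space_sum (f : R * E -> R^o) (h : E) (z : R * E) :
  differentiable f z ->
  'D_((0, h) : R * E) f z = \sum_(i < d) h ord0 i * 'D_(e_ i) f z.
Proof.
move=> df; rewrite deriveE//.
have -> : ((0, h) : R * E) = \sum_(i < d) h ord0 i *: e_ i.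
  rewrite {1}[h]row_sum_delta.
  rewrite (big_morph (fun y : E => (0, y) : R * E) (id1 := 0) (op1 := +%R))//; last first.
    by move=> y y'; congr pair; rewrite /= addr0.
  by apply: eq_bigr => i _; congr pair; rewrite /= scaler0.
by rewrite linear_sum; apply: eq_bigr => i _; rewrite linearZ deriveE.
Qed.

Lemma gradient_dot (p : R -> E -> R) (h : E) (t : R) (x : E) :
  differentiable ((fun z => p z.1 z.2) : R * E -> R^o) (t, x) ->
  'D_((0, h) : R * E) ((fun z => p z.1 z.2) : R * E -> R^o) (t, x)
  = \sum_(i < d) gradient (p t) x ord0 i * h ord0 i.
Proof.
move=> dp; rewrite derive_space_sum//; apply: eq_bigr => i _.
have -> : gradient (p t) x ord0 i
    = 'D_(e_ i) ((fun z => p z.1 z.2) : R * E -> R^o) (t, x).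
  rewrite mxE; exact: (derive_space ((fun z => p z.1 z.2) : R * E -> R^o) t _ x).
exact: mulrC.
Qed.

(** Expand the inner derivative in coordinates near [(t, x)], where [p] is
differentiable, then the outer one at [(t, x)]. *)
Lemma hessian_form (p : R -> E -> R) (h : E) (U : set (R * E)) (t : R) (x : E) :
  open U -> U (t, x) -> class_C 2 U ((fun z => p z.1 z.2) : R * E -> R^o) ->
  'D_((0, h) : R * E) ('D_((0, h) : R * E) ((fun z => p z.1 z.2) : R * E -> R^o)) (t, x)
  = (h *m hessian (p t) x *m h^T) ord0 ord0.
Proof.
set f : R * E -> R^o := fun z => p z.1 z.2.
move=> oU Utx [df d2f].
rewrite derive_space_sum; last exact: (d2f _).1.
have Dij i : 'D_(e_ i) ('D_((0, h) : R * E) f) (t, x)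
    = \sum_(j < d) h ord0 j * 'D_(e_ i) ('D_(e_ j) f) (t, x).
  rewrite (@near_eq_derive _ _ _ _ (\sum_(j < d) (h ord0 j \*: 'D_(e_ j) f))); last first.
    near=> z; rewrite fct_sumE derive_space_sum//; apply: df.
    by near: z; exact: open_nbhs_nbhs.
  have := @is_derive_sum _ _ _ d (fun j => h ord0 j \*: 'D_(e_ j) f) (t, x) (e_ i)
    (fun j => h ord0 j *: 'D_(e_ i) ('D_(e_ j) f) (t, x)) _.
  move=> H; apply: derive_val; apply: H => j; apply: is_deriveZ.
  by apply: derivableP; apply: diff_derivable; exact: (d2f _).1.
rewrite mxE.
under [RHS]eq_bigr do rewrite mxE big_distrl/=.
rewrite exchange_big/=; apply: eq_bigr => i _; rewrite Dij big_distrr/=.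
apply: eq_bigr => j _.
have -> : hessian (p t) x i j = 'D_(e_ i) ('D_(e_ j) f) (t, x).
  have Hj : 'D_(delta_mx ord0 j) (p t) = fun y => 'D_(e_ j) f (t, y).
    by apply/funext => y; exact: (derive_space f t _ y).
  rewrite mxE Hj; exact: (derive_space ('D_(e_ j) f) t _ x).
rewrite mxE; move: ('D_(e_ i) _ _) => D; rewrite -mulrA; congr (_ * _).
exact: mulrC.
Unshelve. all: by end_near. Qed.

End spacetime_derivatives.

Section scalar_product.
Context {R : realType} {d : nat}.
Local Notation E := 'rV[R]_d.
Implicit Types u v : E.

Definition dot u v : R := \sum_(i < d) u ord0 i * v ord0 i.

Lemma dotvv u : dot u u = sqnorm u.
Proof. by apply: eq_bigr => i _; rewrite expr2. Qed.

Lemma dotC u v : dot u v = dot v u.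
Proof. by apply: eq_bigr => i _; rewrite mulrC. Qed.

Lemma dotNl u v : dot (- u) v = - dot u v.
Proof. by rewrite /dot -sumrN; apply: eq_bigr => i _; rewrite mxE mulNr. Qed.

Lemma dot0l v : dot 0 v = 0.
Proof. by apply: big1 => i _; rewrite mxE mul0r. Qed.

Lemma dotZr u v (c : R) : dot u (c *: v) = c * dot u v.
Proof. by rewrite /dot big_distrr/=; apply: eq_bigr => i _; rewrite mxE mulrCA. Qed.

Lemma sqnormD u v : sqnorm (u + v) = sqnorm u + 2 * dot u v + sqnorm v.
Proof.
rewrite /sqnorm /dot big_distrr/= -!big_split/=; apply: eq_bigr => i _.
by rewrite mxE; ring.
Qed.

Lemma sqnormZ (c : R) u : sqnorm (c *: u) = c ^+ 2 * sqnorm u.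
Proof. by rewrite /sqnorm big_distrr/=; apply: eq_bigr => i _; rewrite mxE exprMn. Qed.

Lemma cvg_dot {T : Type} (F : set_system T) {FF : Filter F} (f g : T -> E) u v :
  f @ F --> u -> g @ F --> v -> dot (f x) (g x) @[x --> F] --> dot u v.
Proof.
move=> fu gv; apply: cvg_sum_seq => i; apply: cvgM.
  by apply: (@cvg_comp _ _ _ f (fun w : E => w ord0 i) _ _ _ fu); exact: coord_continuous.
by apply: (@cvg_comp _ _ _ g (fun w : E => w ord0 i) _ _ _ gv); exact: coord_continuous.
Qed.

Lemma is_derive_coord (f : R -> E) (t : R) (df : E) (i : 'I_d) :
  is_derive t 1 (f : R^o -> E) df ->
  is_derive t 1 ((fun s => f s ord0 i) : R^o -> R^o) (df ord0 i).
Proof.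
move=> [fd <-]; split; first exact: (derivable_mxP _ _ _).1 fd ord0 i.
by rewrite derive_mx// mxE.
Qed.

Lemma is_derive_dot (f g : R -> E) (t : R) (df dg : E) :
  is_derive t 1 (f : R^o -> E) df -> is_derive t 1 (g : R^o -> E) dg ->
  is_derive t 1 ((fun s => dot (f s) (g s)) : R^o -> R^o)
    (dot df (g t) + dot (f t) dg).
Proof.
move=> Df Dg.
have -> : ((fun s => dot (f s) (g s)) : R^o -> R^o)
    = \sum_(i < d) ((fun s => f s ord0 i : R^o) * (fun s => g s ord0 i : R^o)).
  by apply/funext => s; rewrite fct_sumE.
rewrite /dot -big_split/=; apply: is_derive_sum => i.
have := is_derive_coord f t df i Df; have := is_derive_coord g t dg i Dg.
move=> Dgi Dfi; apply: (is_derive_eq (is_deriveM Dfi Dgi)).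
by rewrite /GRing.scale/= addrC; congr (_ + _); exact: mulrC.
Qed.

End scalar_product.

Section pressure_expansion.
Context {R : realType} {d : nat}.
Local Notation E := 'rV[R]_d.

(** Convexity keeps the segment from [x] to [y] in [D], where the Hessian is
bounded, so [taylor2_le] applies along it. *)
Lemma pressure_taylor (p : R -> E -> R) (D : set E) (U : set (R * E)) (t c : R) (x y : E) :
  open U -> (forall u, D u -> U (t, u)) ->
  class_C 2 U ((fun z => p z.1 z.2) : R * E -> R^o) ->
  convex_set (D : set (convex_lmodType E)) -> D x -> D y ->
  (forall u v, D u -> (v *m hessian (p t) u *m v^T) ord0 ord0 <= c * sqnorm v) ->
  p t y <= p t x + dot (gradient (p t) x) (y - x) + c * sqnorm (y - x) / 2.
Proof.
move=> oU DU Cp cD Dx Dy hc.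
set P : R * E -> R^o := fun z => p z.1 z.2; set h := y - x.
have lineE s : ((t, x) : R * E) + s *: ((0, h) : R * E) = (t, x + s *: h).
  by apply: (f_equal2 (@pair R E)); rewrite /= ?scaler0 ?addr0.
have Ds s : 0 <= s <= 1 -> D (x + s *: h) by exact: convex_segment.
have Us s : 0 <= s <= 1 -> U ((t, x) + s *: ((0, h) : R * E)).
  by move=> s01; rewrite lineE; apply: DU; exact: Ds.
have := @taylor2_le R (fun s => P ((t, x) + s *: ((0, h) : R * E)))
  (fun s => 'D_((0, h) : R * E) P ((t, x) + s *: ((0, h) : R * E)))
  (fun s => 'D_((0, h) : R * E) ('D_((0, h) : R * E) P) ((t, x) + s *: ((0, h) : R * E)))
  (c * sqnorm h).
rewrite !scale0r !addr0 !lineE scale1r /P/= (addrC x) subrK gradient_dot; last first.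
  by apply: Cp.1; exact: DU.
apply.
- by move=> s s01; apply: is_derive_line; apply: Cp.1; exact: Us.
- by move=> s s01; apply: is_derive_line; apply: (Cp.2 _).1; exact: Us.
- move=> s s01; rewrite lineE (hessian_form _ _ U)//; first by apply: hc; exact: Ds.
  by apply: DU; exact: Ds.
Qed.

End pressure_expansion.

(** * Minimality of solutions of Newton's equation on short intervals *)

(** The pointwise inequality behind the calibration.  Here [hh], [vv], [xx]
are the squared norms of [h], [h'], [x'], and [hv], [ah], [xv] the scalar
products of [h] with [h'], of [x''] with [h], of [x'] with [h'].  The gap
between the two sides is the gap in the bound on the potential plus half of
[|h' - w h|^2]. *)
Lemma calibration_ineq {R : realType} (pz px hh vv xx w k om hv ah xv : R) :
  pz <= px - ah + k ^+ 2 * hh / 2 ->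
  0 <= vv + 2 * (- w * hv) + w ^+ 2 * hh ->
  - px + xx / 2 + (ah + (xv + (w * hv - (om ^+ 2 + w ^+ 2) * (hh / 2))))
  <= - pz + (xx + 2 * xv + vv) / 2 + (k ^+ 2 - om ^+ 2) * (hh / 2).
Proof.
move=> h1 h2; rewrite -subr_ge0.
rewrite (_ : _ - _ = (px - ah + k ^+ 2 * hh / 2 - pz)
  + (vv + 2 * (- w * hv) + w ^+ 2 * hh) / 2); last by field.
by rewrite addr_ge0 ?subr_ge0// divr_ge0.
Qed.

(** Frequencies just below [k] make the deficit of the calibration as small as
needed. *)
Lemma subcritical_frequency {R : realType} (k H e : R) : 0 < k -> 0 <= H -> 0 < e ->
  exists2 om, 0 < om < k & (k ^+ 2 - om ^+ 2) * H <= e.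
Proof.
move=> k0 H0 e0; have kH : 0 <= k ^+ 2 * H by rewrite mulr_ge0// sqr_ge0.
pose M := 2 * (k ^+ 2 * H) + 1.
have M0 : 0 < M by rewrite /M; lra.
pose dl := Num.min (2^-1) (e / M).
have dl0 : 0 < dl by rewrite lt_min invr_gt0 ltr0n divr_gt0.
have dl1 : dl <= 2^-1 by rewrite ge_min lexx.
have dlM : dl * M <= e by rewrite -ler_pdivlMr// ge_min lexx orbT.
exists ((1 - dl) * k); first by apply/andP; split; nra.
have -> : (k ^+ 2 - ((1 - dl) * k) ^+ 2) * H = dl * M - dl - dl ^+ 2 * (k ^+ 2 * H).
  by rewrite /M; ring.
by have := mulr_ge0 (sqr_ge0 dl) kH; lra.
Qed.

Section minimality.
Context {R : realType} {d : nat}.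
Local Notation E := 'rV[R]_d.
Variables (t0 t1 : R).
Hypothesis t01 : t0 < t1.
Local Notation leb := (@lebesgue_measure R).
Local Notation I := (`[t0, t1]%classic : set R).

(** The solution of the Riccati equation [w' = - (om^2 + w^2)] centred at the
middle of the interval; it stays finite on all of it when
[om < pi / (t1 - t0)]. *)
Definition weight (om t : R) : R := - om * tan (om * (t - (t0 + t1) / 2)).

Lemma is_derive_weight (om t : R) : 0 < om < pi / (t1 - t0) -> t \in `[t0, t1] ->
  is_derive t 1 (weight om : R^o -> R^o) (- (om ^+ 2 + weight om t ^+ 2)).
Proof.
move=> /andP[om0 omT]; rewrite in_itv/= => /andP[t0t tt1].
have T0 : 0 < t1 - t0 by rewrite subr_gt0.
have omT' : om * (t1 - t0) < pi by rewrite -ltr_pdivlMr.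
set th := om * (t - (t0 + t1) / 2).
have c0 : cos th != 0.
  rewrite gt_eqF// cos_gt0_pihalf// /th; apply/andP; split; nra.
have dth : is_derive t 1 ((fun s => om * (s - (t0 + t1) / 2)) : R -> R) om.
  have -> : (fun s => om * (s - (t0 + t1) / 2)) = (om \*: (id - cst ((t0 + t1) / 2))).
    by apply/funext => s.
  by apply: is_derive_eq; rewrite subr0 /GRing.scale/= mulr1.
have -> : (weight om : R^o -> R^o)
    = (- om) \*: (tan \o (fun s => om * (s - (t0 + t1) / 2))) by apply/funext => s.
have dtan := @is_derive1_comp R tan (fun s => om * (s - (t0 + t1) / 2)) t _ om (is_derive_tan c0) dth.
apply: (is_derive_eq (is_deriveZ (- om) dtan)).
by rewrite cos2_tan2// /= /GRing.scale/= -/th; ring.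
Qed.

Section comparison.
Variables (D : set E) (p : R -> E -> R) (x z a : R -> E) (xa ya : E).
Hypotheses (cp : continuous_field D t0 t1 p)
  (cx : curves D t0 t1 xa ya x) (cz : curves D t0 t1 xa ya z).
Hypothesis dx : forall t, t \in `[t0, t1] -> is_derive t 1 (derive1 x : R^o -> E) (a t).
Hypothesis ca : {within I, continuous a}.
Hypothesis pz : forall t, t \in `[t0, t1] ->
  p t (z t) <= p t (x t) - dot (a t) (z t - x t)
    + (pi / (t1 - t0)) ^+ 2 * sqnorm (z t - x t) / 2.

Let h t : E := z t - x t.
Let dh t : E := derive1 z t - derive1 x t.

Let cvg_curve y : curves D t0 t1 xa ya y -> forall t, t \in `[t0, t1] ->
  [/\ y s @[s --> t] --> y t, derive1 y s @[s --> t] --> derive1 y t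
    & is_derive t 1 (y : R^o -> E) (derive1 y t)].
Proof.
move=> [[U [oU IU Cy]] _ _ _] t It; have Ut := IU _ It; split.
- exact: class_C1_continuous Cy Ut.
- exact: class_C1_continuous_derive1 Cy Ut.
- by rewrite derive1E; apply: derivableP; exact: class_C1_derivable Cy Ut.
Qed.

Let cvg_h t : t \in `[t0, t1] -> h s @[s --> t] --> h t.
Proof.
move=> It; have [c1 _ _] := cvg_curve x cx t It; have [c2 _ _] := cvg_curve z cz t It.
exact: (cvgB c2 c1).
Qed.

Let cvg_dh t : t \in `[t0, t1] -> dh s @[s --> t] --> dh t.
Proof.
move=> It; have [_ c1 _] := cvg_curve x cx t It; have [_ c2 _] := cvg_curve z cz t It.
exact: (cvgB c2 c1).
Qed.

Let is_derive_h t : t \in `[t0, t1] -> is_derive t 1 (h : R^o -> E) (dh t).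
Proof.
move=> It; have [_ _ d1] := cvg_curve x cx t It; have [_ _ d2] := cvg_curve z cz t It.
exact: (is_deriveB d2 d1).
Qed.

Let sqnorm_h_continuous : {within I, continuous (fun t => sqnorm (h t) / 2)}.
Proof.
apply/subspace_continuousP => t It; apply: cvg_within_filter; apply: cvgMr_tmp.
by apply: continuous_cvg; [exact: sqnorm_continuous|exact: cvg_h].
Qed.

Section calibration.
Variable om : R.
Hypothesis omT : 0 < om < pi / (t1 - t0).

(* its derivative absorbs the first order terms, and it vanishes where h does *)
Let B t : R := dot (derive1 x t) (h t) + weight om t * (dot (h t) (h t) / 2).
Let dB t : R := dot (a t) (h t) + (dot (derive1 x t) (dh t)
  + (weight om t * dot (h t) (dh t)
     - (om ^+ 2 + weight om t ^+ 2) * (dot (h t) (h t) / 2))).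

Let is_derive_B t : t \in `[t0, t1] -> is_derive t 1 (B : R^o -> R^o) (dB t).
Proof.
move=> It; have Dh := is_derive_h t It.
have Dxh := is_derive_dot _ _ _ _ _ (dx t It) Dh.
have Dhh := is_derive_dot _ _ _ _ _ Dh Dh.
have Dw := is_derive_weight om t omT It.
have Dhh2 : is_derive t 1 ((fun s => dot (h s) (h s) / 2) : R^o -> R^o) (dot (h t) (dh t)).
  have -> : ((fun s => dot (h s) (h s) / 2) : R^o -> R^o)
     = 2^-1 \*: ((fun s => dot (h s) (h s)) : R^o -> R^o).
    by apply/funext => s; rewrite /GRing.scale/= mulrC.
  apply: (is_derive_eq (is_deriveZ _ Dhh)).
  by rewrite (dotC (dh t)) /GRing.scale/=; lra.
have := is_deriveD Dxh (is_deriveM Dw Dhh2) => DB.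
by apply: (is_derive_eq DB); rewrite /dB /GRing.scale/=; ring.
Qed.

Let dB_continuous : {within I, continuous dB}.
Proof.
apply/subspace_continuousP => t It.
have cw : weight om s @[s --> t] --> weight om t.
  have [dw _] := is_derive_weight om t omT It.
  by apply: differentiable_continuous; exact/derivable1_diffP.
have ch := cvg_h t It; have cdh := cvg_dh t It.
have [_ cdx _] := cvg_curve x cx t It.
have ca' : a s @[s --> within I (nbhs t)] --> a t by exact: (subspace_continuousP _ _).1 ca t It.
have cww : om ^+ 2 + weight om s ^+ 2 @[s --> t] --> om ^+ 2 + weight om t ^+ 2.
  apply: cvgD; first exact: cvg_cst.
  by under eq_fun do rewrite expr2; rewrite expr2; exact: cvgM.
have c2 : dot (derive1 x s) (dh s) + (weight om s * dot (h s) (dh s)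
    - (om ^+ 2 + weight om s ^+ 2) * (dot (h s) (h s) / 2)) @[s --> t]
  --> dot (derive1 x t) (dh t) + (weight om t * dot (h t) (dh t)
    - (om ^+ 2 + weight om t ^+ 2) * (dot (h t) (h t) / 2)).
  apply: cvgD; first exact: (cvg_dot (nbhs t) _ _ _ _ cdx cdh).
  apply: cvgB; first exact: (cvgM cw (cvg_dot (nbhs t) _ _ _ _ ch cdh)).
  by apply: (cvgM cww); apply: cvgMr_tmp; exact: (cvg_dot (nbhs t) _ _ _ _ ch ch).
apply: cvgD; last exact: cvg_within_filter.
by apply: cvg_dot; [exact: ca'|exact: cvg_within_filter].
Qed.

Let integral_dB : \int[leb]_(t in I) dB t = 0.
Proof.
have hends : h t0 = 0 /\ h t1 = 0.
  by move: cx cz => [_ _ x0 x1] [_ _ z0 z1]; rewrite /h x0 x1 z0 z1 !subrr.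
rewrite /Rintegral (@continuous_FTC2 R dB B t0 t1 t01 dB_continuous).
- by rewrite /B hends.1 hends.2 !(dotC _ 0) !dot0l mul0r !mulr0 !addr0 subee.
- have cB t : t \in `[t0, t1] -> B s @[s --> t] --> B t.
    move=> It; have [dBt _] := is_derive_B t It.
    by apply: differentiable_continuous; exact/derivable1_diffP.
  split.
  + by move=> t /subset_itv_oo_cc It; have [] := is_derive_B t It.
  + by apply: cvg_at_right_filter; apply: cB; rewrite in_itv/= lexx ltW.
  + by apply: cvg_at_left_filter; apply: cB; rewrite in_itv/= lexx ltW.
- move=> t /subset_itv_oo_cc It; rewrite derive1E.
  by have [_ ->] := is_derive_B t It.
Qed.

(** The Lagrangian of [z] exceeds that of [x] by at least the derivative of [B],
up to the deficit between [om] and the critical frequency. *)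
Lemma calibrated_action :
  \int[leb]_(t in I) lagrangian p x t <= \int[leb]_(t in I) lagrangian p z t
    + ((pi / (t1 - t0)) ^+ 2 - om ^+ 2) * \int[leb]_(t in I) (sqnorm (h t) / 2).
Proof.
set c := _ - _.
have ix := lagrangian_integrable _ _ _ _ _ _ _ cp cx.
have iz := lagrangian_integrable _ _ _ _ _ _ _ cp cz.
have ih := continuous_integrable _ _ _ sqnorm_h_continuous.
have iB := continuous_integrable _ _ _ dB_continuous.
have mI : measurable (I : set (measurableTypeR R)) by exact: measurable_itv.
have ich : leb.-integrable I (EFin \o (fun t => c * (sqnorm (h t) / 2))).
  exact: (integrableZl mI c ih).
have e1 := RintegralD mI ix iB.
have e2 := RintegralD mI iz ich.
have e3 := RintegralZl c mI ih.
rewrite integral_dB addr0 in e1; rewrite -e1 -e3 -e2.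
apply: le_Rintegral => //.
- exact: (integrableD mI ix iB).
- exact: (integrableD mI iz ich).
- move=> t It; have := pz t It; rewrite /lagrangian -/(h t).
  have -> : derive1 z t = derive1 x t + dh t by rewrite /dh addrC subrK.
  have := sqnorm_ge0 (dh t - weight om t *: h t).
  rewrite (sqnormD (derive1 x t) (dh t)) (sqnormD (dh t)) -scaleNr sqnormZ dotZr.
  rewrite sqrrN (dotC (dh t)) /c /dB dotvv => sq_ge0 pzt.
  move: sq_ge0.
  move: (dot (h t) (dh t)) (dot (a t) (h t)) (dot (derive1 x t) (dh t)) pzt.
  move: (sqnorm (h t)) (sqnorm (dh t)) (sqnorm (derive1 x t)) (weight om t) (pi / (t1 - t0)).
  move: (p t (z t)) (p t (x t)) => pz' px' A4 A5 A6 w k A1 A2 A3.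
  exact: calibration_ineq.
Qed.

End calibration.

(** The weight blows up at the ends of the interval for the critical frequency
[pi / (t1 - t0)], which is therefore reached as a limit of calibrations. *)
Lemma trajectory_minimizes : (action t0 t1 p x <= action t0 t1 p z)%E.
Proof.
rewrite (actionE _ _ _ _ _ _ _ cp cx) (actionE _ _ _ _ _ _ _ cp cz) lee_fin.
have k0 : 0 < pi / (t1 - t0) by rewrite divr_gt0 ?pi_gt0// subr_gt0.
have H0 : 0 <= \int[leb]_(t in I) (sqnorm (h t) / 2).
  by apply: Rintegral_ge0 => t _; rewrite divr_ge0// sqnorm_ge0.
apply/ler_addgt0Pr => e e0.
have [om om01 ome] := subcritical_frequency _ _ _ k0 H0 e0.
by apply: le_trans (calibrated_action om om01) _; rewrite lerD2l.
Qed.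

End comparison.
End minimality.

(** * The dual functional along an Euler flow *)

Section euler_flow.
Context {R : realType} {d : nat}.
Local Notation E := 'rV[R]_d.
Local Notation T := (measurableTypeR R * E)%type.
Variables (D : set E) (t0 t1 : R) (g : R -> E -> E) (p : R -> E -> R).
Hypotheses (hD : bounded_convex_domain D) (t01 : t0 < t1).
Hypothesis hgp : smooth_euler_solution D t0 t1 g p.
Hypothesis hp : spacetime_integrable D t0 t1 p.
Hypothesis hsmall : forall t x, t \in `[t0, t1] -> D x ->
  loewner_le ((t1 - t0) ^+ 2 *: hessian (p t) x) (pi ^+ 2)%:M.
Local Notation leb := (@lebesgue_measure R).
Local Notation mu := (@lebesgue_measure R \x lebesgue_rV d)%E.
Local Notation I := (`[t0, t1]%classic : set R).
Local Notation S := (spacetime D t0 t1).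
Local Notation particle x := (fun s => g s x).

Let openD : open D. Proof. by case: hD. Qed.
Let convD : convex_set (D : set (convex_lmodType E)). Proof. by case: hD. Qed.
Let mD : measurable D. Proof. exact: open_measurable_rV. Qed.
Let mI : measurable (I : set (measurableTypeR R)). Proof. exact: measurable_itv. Qed.
Let mS : measurable (S : set T). Proof. exact: measurable_spacetime. Qed.

Let G : R * E -> E := fun z => g z.1 z.2.

Let t0I : t0 \in `[t0, t1]. Proof. by rewrite in_itv/= lexx ltW. Qed.
Let t1I : t1 \in `[t0, t1]. Proof. by rewrite in_itv/= lexx ltW. Qed.

Let gD t x : t \in `[t0, t1] -> D x -> D (g t x).
Proof. by move=> tI Dx; have [+ _ _] := SDiff_bij (euler_SDiff hgp tI); apply. Qed.

Let inv_onK t x : t \in `[t0, t1] -> D x -> inv_on D (g t) (g t x) = x.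
Proof.
move=> tI Dx; have [_ inj _] := SDiff_bij (euler_SDiff hgp tI).
by rewrite /inv_on pinvKV// inE.
Qed.

Lemma smooth_on_continuous {V W : normedModType R} (A : set V) (f : V -> W) :
  smooth_on A f -> forall x, A x -> {for x, continuous f}.
Proof.
move=> [U [_ AU Cf]] x Ax; apply: differentiable_continuous.
by have [df _] := Cf 1%N; apply: df; exact: AU.
Qed.

Let cont_G : {within S, continuous G}.
Proof.
apply/subspace_continuousP => z Sz; apply: cvg_within_filter.
exact: smooth_on_continuous (euler_smooth_flow hgp) z Sz.
Qed.

Let cont_p : continuous_field D t0 t1 p.
Proof.
apply/subspace_continuousP => z Sz; apply: cvg_within_filter.
exact: smooth_on_continuous (euler_smooth_pressure hgp) z Sz.
Qed.

Let cont_g t x : t \in `[t0, t1] -> D x -> {for x, continuous (g t)}.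
Proof.
move=> tI Dx.
have cG : {for (t, x), continuous G}.
  by apply: (smooth_on_continuous S G (euler_smooth_flow hgp)).
apply: (cvg_comp (fun y : E => (t, y)) G _ cG).
by apply: (cvg_to_pair (nbhs x) (fun _ => t) id t x); [exact: cvg_cst|exact: cvg_id].
Qed.

Let derive1_particle x : derive1 (particle x) = fun s => 'D_((1, 0) : R * E) G (s, x).
Proof. by apply/funext => s; rewrite derive1E; exact: (derive_time G). Qed.

Let particle_curve x : D x -> curves D t0 t1 (g t0 x) (g t1 x) (particle x).
Proof.
move=> Dx; split => //; last by move=> t tI; exact: gD.
have [U [oU SU CG]] := euler_smooth_flow hgp.
have cpair : continuous (fun s : R => (s, x) : R * E).
  by move=> s; apply: (cvg_to_pair (nbhs s) id (fun _ => x) s x); [exact: cvg_id|exact: cvg_cst].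
exists ((fun s => (s, x)) @^-1` U); split.
- by apply: open_comp => // s _; exact: cpair.
- by move=> t tI; apply: SU; split.
have [dG dG1] := CG 1%N.
split => [s Us|v s /set_mem Us].
  by apply/derivable1_diffP; apply: (derivable_time G); exact: dG.
have -> : (fun u : R^o => 'D_v (particle x : R^o -> E) u)
    = (fun u => 'D_((v, 0) : R * E) G (u, x)).
  by apply/funext => u; exact: (derive_time G).
have cv : {in U, continuous (fun z => 'D_((v, 0) : R * E) G z)} := dG1 _.
have cvs : {for (s, x), continuous (fun z => 'D_((v, 0) : R * E) G z)}.
  exact: cv (mem_set Us).
exact: (cvg_comp (fun u : R => (u, x) : R * E) _ (cpair s) cvs).
Qed.

Let accel x t : E := - gradient (p t) (g t x).

Let is_derive_velocity x t : D x -> t \in `[t0, t1] ->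
  is_derive t 1 (derive1 (particle x) : R^o -> E) (accel x t).
Proof.
move=> Dx tI; have [U [oU SU CG]] := euler_smooth_flow hgp.
have [_ dG1] := CG 2%N.
have dv : derivable (derive1 (particle x) : R^o -> E) t 1.
  rewrite derive1_particle; apply: (derivable_time ('D_((1, 0) : R * E) G) t x).
  by apply: (dG1 _).1; apply: SU.
apply: (is_derive_eq (derivableP dv)).
have := euler_eq hgp tI (gD t x tI Dx); rewrite inv_onK// => /eqP.
by rewrite addr_eq0 => /eqP e; rewrite /accel -e /= derive1E.
Qed.

Let accel_continuous x : D x -> {within I, continuous (accel x)}.
Proof.
move=> Dx; have [U [oU SU CG]] := euler_smooth_flow hgp.
have c2 : {in U, continuous (fun z => 'D_((1, 0) : R * E) ('D_((1, 0) : R * E) G) z)}.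
  by have [_ dG1] := CG 2%N; have [_ dG2] := dG1 ((1, 0) : R * E); exact: (dG2 (1, 0)).
have E1 t : t \in `[t0, t1] ->
    accel x t = 'D_((1, 0) : R * E) ('D_((1, 0) : R * E) G) (t, x).
  move=> tI; have [_ <-] := is_derive_velocity x t Dx tI.
  by rewrite derive1_particle; exact: (derive_time ('D_((1, 0) : R * E) G)).
apply/subspace_continuousP => t It.
have ct : 'D_((1, 0) : R * E) ('D_((1, 0) : R * E) G) (s, x) @[s --> t]
    --> accel x t.
  rewrite (E1 t It).
  have c2t : {for (t, x), continuous
      (fun z => 'D_((1, 0) : R * E) ('D_((1, 0) : R * E) G) z)}.
    by apply: c2; apply: mem_set; apply: SU; split.
  apply: (cvg_comp (fun u : R => (u, x) : R * E) _ _ c2t).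
  by apply: (cvg_to_pair (nbhs t) id (fun _ => x) t x); [exact: cvg_id|exact: cvg_cst].
apply: cvg_trans (cvg_within_filter I ct).
apply: near_eq_cvg; near=> s.
have sI : I s by near: s; exact: withinT.
exact: (esym (E1 s sI)).
Unshelve. all: by end_near. Qed.

Let hessian_bound t u v : t \in `[t0, t1] -> D u ->
  (v *m hessian (p t) u *m v^T) ord0 ord0 <= (pi / (t1 - t0)) ^+ 2 * sqnorm v.
Proof.
move=> tI Du; have := hsmall t u tI Du v.
have T0 : 0 < (t1 - t0) ^+ 2 by rewrite exprn_gt0// subr_gt0.
rewrite -scalemxAr -scalemxAl mxE mul_mx_scalar -scalemxAl [leRHS]mxE => h.
have vv : (v *m v^T) ord0 ord0 = sqnorm v.
  by rewrite mxE; apply: eq_bigr => i _; rewrite mxE expr2.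
by rewrite expr_div_n mulrAC ler_pdivlMr// mulrC -vv.
Qed.

(** Newton's equation for the particles is the Euler equation, and the Hessian
bound makes the time interval short enough for their paths to be minimizing. *)
Lemma J_pressure x : D x ->
  (action t0 t1 p (particle x) <= J D t0 t1 p (g t0 x) (g t1 x))%E.
Proof.
move=> Dx; apply: le_ereal_inf_tmp => _ [z cz <-].
apply: (trajectory_minimizes t0 t1 t01 D p (particle x) z (accel x) (g t0 x) (g t1 x)) => //.
- exact: particle_curve.
- by move=> t; exact: is_derive_velocity.
- exact: accel_continuous.
move=> t tI; have [U [oU SU CP]] := euler_smooth_pressure hgp.
have Dz : D (z t) by have [_ + _ _] := cz; apply.
rewrite dotNl opprK.
apply: (pressure_taylor p D U t _ (g t x) (z t) oU _ (CP 2%N) convD (gD t x tI Dx) Dz).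
- by move=> u Du; apply: SU; split.
- by move=> u v Du; exact: hessian_bound.
Qed.

(** Sublevel sets of an upper semicontinuous function of the end points, pulled
back by the continuous maps [g t0] and [g t1]. *)
Lemma measurable_J q : continuous_field D t0 t1 q ->
  measurable_fun D (fun x => J D t0 t1 q (g t0 x) (g t1 x)).
Proof.
move=> cq; apply: (measurability _ (ErealGenInftyO.measurableE R)).
move=> _ [_ [a ->] <-]; apply: open_measurable_rV.
rewrite openE => x [Dx xa].
have ax : (J D t0 t1 q (g t0 x) (g t1 x) < a%:E)%E by move: xa; rewrite /= in_itv.
have near_a := J_upper_semicontinuous D t0 t1 openD t01 q _ _ a cq ax.
have cgg : (g t0 y, g t1 y) @[y --> x] --> (g t0 x, g t1 x).
  exact: (cvg_to_pair (nbhs x) (g t0) (g t1) _ _ (cont_g t0 x t0I Dx) (cont_g t1 x t1I Dx)).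
have nD : \forall y \near x, D y by exact: (open_nbhs_nbhs (conj openD Dx)).
have na : \forall y \near x, (J D t0 t1 q (g t0 y) (g t1 y) < a%:E)%E := cgg _ near_a.
by apply: filterS2 nD na => y Dy ya; split => //=; rewrite in_itv.
Qed.

Let kin (z : R * E) : R := sqnorm ('D_((1, 0) : R * E) G z) / 2.

Let kin_continuous : {within S, continuous kin}.
Proof.
have [U [oU SU CG]] := euler_smooth_flow hgp.
have c1 : {in U, continuous (fun z => 'D_((1, 0) : R * E) G z)}.
  by have [_ dG1] := CG 1%N; exact: (dG1 (1, 0)).
apply/subspace_continuousP => z Sz; apply: cvg_within_filter.
apply: cvgMr_tmp; apply: continuous_cvg; first exact: sqnorm_continuous.
by apply: (c1 z); apply: mem_set; exact: SU.
Qed.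

(** The kinetic action of a particle, finite at each point of [D] although the
velocity may be unbounded near the boundary. *)
Let K (x : E) : \bar R := (\int[leb]_(t in I) (kin (t, x))%:E)%E.
Let Q (q : R -> E -> R) (x : E) : \bar R := (\int[leb]_(t in I) (q t (g t x))%:E)%E.

Let measurable_K : measurable_fun D K.
Proof.
apply: (measurable_integral_rectangle (@lebesgue_measure R) I D mI mD
  (fun z => (kin z)%:E)) => [|z _]; last by rewrite lee_fin divr_ge0// sqnorm_ge0.
apply/measurable_EFinP; exact: within_continuous_measurable mS kin_continuous.
Qed.

Let action_particle q x : continuous_field D t0 t1 q -> D x ->
  [/\ action t0 t1 q (particle x) = (- Q q x + K x)%E,
    Q q x \is a fin_num & K x \is a fin_num].
Proof.
move=> cq Dx; have cx := particle_curve x Dx.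
have QE := continuous_integralE t0 t1 _ (potential_continuous D t0 t1 q _ _ _ cq cx).
have KE : K x = (\int[leb]_(t in I) (sqnorm (derive1 (particle x) t) / 2))%:E.
  rewrite -(continuous_integralE t0 t1 _ (kinetic_continuous D t0 t1 _ _ _ cx)).
  by apply: eq_integral => t _; rewrite derive1_particle.
by split; rewrite ?/Q ?QE ?KE// (action_split _ _ _ _ _ _ _ cq cx).
Qed.

Let J_upper q x : continuous_field D t0 t1 q -> D x ->
  (J D t0 t1 q (g t0 x) (g t1 x) <= - Q q x + K x)%E.
Proof.
move=> cq Dx; have [<- _ _] := action_particle q x cq Dx.
by apply: J_le_action; exact: particle_curve.
Qed.

Let J_lty q x : continuous_field D t0 t1 q -> D x ->
  J D t0 t1 q (g t0 x) (g t1 x) != +oo%E.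
Proof.
move=> cq Dx; have [_ fQ fK] := action_particle q x cq Dx.
rewrite -ltey; apply: le_lt_trans (J_upper q x cq Dx) _.
by rewrite -(fineK fQ) -(fineK fK) -EFinN -EFinD ltry.
Qed.

Let spacetime_integral q : scalar_field D t0 t1 q ->
  [/\ (\int[leb]_(t in I) \int[lebesgue_rV d]_(x in D) (q t x)%:E
       = \int[mu]_(z in S) (q z.1 z.2)%:E)%E,
    (\int[lebesgue_rV d]_(x in D) Q q x = \int[mu]_(z in S) (q z.1 z.2)%:E)%E,
    (\int[mu]_(z in S) (q z.1 z.2)%:E)%E \is a fin_num
    & (lebesgue_rV d).-integrable D (Q q)].
Proof.
move=> [cq iq].
have vol t tI := SDiff_volume (euler_SDiff hgp (t := t) tI).
have [iqg qgE] := flow_integral D t0 t1 g openD cont_G gD vol q iq.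
have [r1 _] := integral_rectangle leb (lebesgue_rV d) I D mI mD _ iq.
have [_ r2] := integral_rectangle leb (lebesgue_rV d) I D mI mD _ iqg.
split.
- exact: r1.
- exact: etrans r2 qgE.
- exact: integrable_fin_num.
- exact: (integrable_integral_rectangle leb (lebesgue_rV d) I D mI mD _ iqg).
Qed.

(** The average of [q] over space-time is moved under the integral over the
particles, where it cancels the potential part of the action of their paths.
*)
Lemma dual_functional_upper q : scalar_field D t0 t1 q ->
  (dual_functional D t0 t1 g q <= \int[lebesgue_rV d]_(x in D) K x)%E.
Proof.
move=> sq; have [cq _] := sq; have [e1 e2 _ iQ] := spacetime_integral q sq.
rewrite /dual_functional e1 -e2.
have mQ : measurable_fun D (Q q) by case/integrableP: iQ.
have mJ := measurable_J q cq.
apply: le_trans (le_integralD (lebesgue_rV d) D mD _ _ mQ mJ _ _) _.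
- by move=> x Dx; have [_ fQ _] := action_particle q x cq Dx; rewrite -(fineK fQ).
- by move=> x Dx; exact: J_lty.
apply: le_integral_measurable => //; first exact: emeasurable_funD.
move=> x Dx; have [_ fQ _] := action_particle q x cq Dx.
apply: le_trans (leeD2l _ (J_upper q x cq Dx)) _.
by rewrite addeA subee// add0e.
Qed.

Lemma scalar_field_pressure : scalar_field D t0 t1 p.
Proof. by split. Qed.

(** Minimality of the particle paths for the pressure; if the total kinetic
action is infinite, so is the value of the functional. *)
Lemma dual_functional_pressure_lower :
  (\int[lebesgue_rV d]_(x in D) K x <= dual_functional D t0 t1 g p)%E.
Proof.
have [e1 e2 fI iQ] := spacetime_integral p scalar_field_pressure.
rewrite /dual_functional e1.
have mQ : measurable_fun D (Q p) by case/integrableP: iQ.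
have mJ := measurable_J p cont_p.
have mNQ : measurable_fun D (fun x => - Q p x)%E by exact: measurableT_comp.
have NQ : (\int[lebesgue_rV d]_(x in D) (- Q p x)
    = - \int[mu]_(z in S) (p z.1 z.2)%:E)%E.
  rewrite -e2; apply: integralN.
  exact: integrable_add_def.
have : (\int[lebesgue_rV d]_(x in D) (- Q p x) + \int[lebesgue_rV d]_(x in D) K x
   <= \int[lebesgue_rV d]_(x in D) J D t0 t1 p (g t0 x) (g t1 x))%E.
  apply: le_trans (le_integralD (lebesgue_rV d) D mD _ _ mNQ measurable_K _ _) _.
  - move=> x Dx; have [_ fQ _] := action_particle p x cont_p Dx.
    by rewrite -(fineK fQ).
  - move=> x Dx; have [_ _ fK] := action_particle p x cont_p Dx.
    by rewrite -(fineK fK).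
  apply: le_integral_measurable => //; first exact: emeasurable_funD.
  move=> x Dx; have [<- _ _] := action_particle p x cont_p Dx.
  exact: J_pressure.
rewrite NQ -(fineK fI); move: (fine _) => r.
by move=> h; rewrite -leeBlDl//; apply: le_trans h; rewrite addeC.
Qed.

(** The endpoint weights [l = 0] and [l = 1] are separate because there one of
the two terms disappears even when the functional is infinite.  For the other
ones the space-time integral is linear and finite, and the inequality is that of
[J_concave], integrated. *)
Lemma dual_functional_concave :
  concave_on (scalar_field D t0 t1) (dual_functional D t0 t1 g).
Proof.
move=> q1 q2 l s1 s2 /andP[l0 l1].
have [l_eq0|l_neq0] := eqVneq l 0.
  rewrite l_eq0 mul0e add0e subr0 mul1e le_eqVlt; apply/orP; left; apply/eqP.
  by congr (dual_functional _ _ _ _ _); apply/funext => t; apply/funext => x; rewrite mul0r add0r mul1r.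
have [l_eq1|l_neq1] := eqVneq l 1.
  rewrite l_eq1 subrr mul0e adde0 mul1e le_eqVlt; apply/orP; left; apply/eqP.
  by congr (dual_functional _ _ _ _ _); apply/funext => t; apply/funext => x; rewrite mul0r addr0 mul1r.
have l_gt0 : 0 < l by rewrite lt_neqAle eq_sym l_neq0.
have l_lt1 : 0 < 1 - l by rewrite subr_gt0 lt_neqAle l_neq1.
have [c1 i1] := s1; have [c2 i2] := s2.
set q := fun t x => l * q1 t x + (1 - l) * q2 t x.
have cq : continuous_field D t0 t1 q.
  apply/subspace_continuousP => z Sz; apply: cvgD.
    by apply: cvgMl_tmp; exact: (subspace_continuousP _ _).1 c1 z Sz.
  by apply: cvgMl_tmp; exact: (subspace_continuousP _ _).1 c2 z Sz.
have iqE : ((fun z : T => (q z.1 z.2)%:E) =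
    (fun z => l%:E * (q1 z.1 z.2)%:E) \+ (fun z => (1 - l)%:E * (q2 z.1 z.2)%:E))%E.
  by apply/funext => z; rewrite /= -!EFinM -EFinD.
have il1 := integrableZl mS l i1; have il2 := integrableZl mS (1 - l) i2.
have iq : spacetime_integrable D t0 t1 q.
  by rewrite /spacetime_integrable iqE; exact: integrableD.
have [e _ _ _] := spacetime_integral q (conj cq iq).
have [e1 _ f1 _] := spacetime_integral q1 s1.
have [e2 _ f2 _] := spacetime_integral q2 s2.
rewrite /dual_functional e e1 e2 iqE integralD// !integralZl//.
have m1 := measurable_J q1 c1; have m2 := measurable_J q2 c2.
have mJ := measurable_J q cq.
set J1 := (\int[lebesgue_rV d]_(x in D) J D t0 t1 q1 _ _)%E.
set J2 := (\int[lebesgue_rV d]_(x in D) J D t0 t1 q2 _ _)%E.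
have JJ : (l%:E * J1 + (1 - l)%:E * J2
    <= \int[lebesgue_rV d]_(x in D) J D t0 t1 q (g t0 x) (g t1 x))%E.
  rewrite -(integralZl_measurable _ _ mD _ _ m1 l_gt0) -(integralZl_measurable _ _ mD _ _ m2 l_lt1).
  have m1' : measurable_fun D (fun x => l%:E * J D t0 t1 q1 (g t0 x) (g t1 x))%E.
    exact: measurable_funeM.
  have m2' : measurable_fun D (fun x => (1 - l)%:E * J D t0 t1 q2 (g t0 x) (g t1 x))%E.
    exact: measurable_funeM.
  apply: le_trans (le_integralD (lebesgue_rV d) D mD _ _ m1' m2' _ _) _.
  - move=> x Dx; have := J_lty q1 x c1 Dx.
    by case: (J D t0 t1 q1 _ _) => [r||] // _; rewrite gt0_muleNy ?lte_fin.
  - move=> x Dx; have := J_lty q2 x c2 Dx.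
    by case: (J D t0 t1 q2 _ _) => [r||] // _; rewrite gt0_muleNy ?lte_fin.
  apply: le_integral_measurable => //; first exact: emeasurable_funD.
  by move=> x Dx; apply: J_concave; rewrite ?l0.
exact: (le_combination_shift _ _ _ _ _ _ _ f1 f2 JJ).
Qed.

Lemma pressure_maximizer :
  maximizer_on (scalar_field D t0 t1) (dual_functional D t0 t1 g) p.
Proof.
split=> [|q sq]; first exact: scalar_field_pressure.
exact: le_trans (dual_functional_upper q sq) dual_functional_pressure_lower.
Qed.

End euler_flow.

Theorem theorem3p1 (R : realType) (d : nat) (D : set 'rV[R]_d) (t0 t1 : R)
  (g : R -> 'rV[R]_d -> 'rV[R]_d) (p : R -> 'rV[R]_d -> R)
  (hd : (0 < d)%N) (hD : bounded_convex_domain D) (ht : t0 < t1)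
  (hgp : smooth_euler_solution D t0 t1 g p)
  (hp : spacetime_integrable D t0 t1 p)
  (hsmall : forall t x, t \in `[t0, t1] -> D x ->
     loewner_le ((t1 - t0) ^+ 2 *: hessian (p t) x) (pi ^+ 2)%:M) :
  concave_on (scalar_field D t0 t1) (dual_functional D t0 t1 g) /\
  maximizer_on (scalar_field D t0 t1) (dual_functional D t0 t1 g) p.
Proof.
split; first exact: dual_functional_concave hD ht hgp.
exact: pressure_maximizer hD ht hgp hp hsmall.
Qed.
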